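(* For any $\mu_1,\mu_2\in\Lambda^+$, there is a unique $\mathbb C$-algebra homomorphism $$\Delta^{\mathrm{rtt}}_{-\mu_1,-\mu_2}\colon X^{\mathrm{rtt}}_{-\mu_1-\mu_2}(\mathfrak{so}_{2r})\longrightarrow X^{\mathrm{rtt}}_{-\mu_1}(\mathfrak{so}_{2r})\otimes X^{\mathrm{rtt}}_{-\mu_2}(\mathfrak{so}_{2r})$$ defined by $\Delta^{\mathrm{rtt}}_{-\mu_1,-\mu_2}(T(z))=T(z)\otimes T(z)$, i.e. $t_{ij}(z)\mapsto\sum_{k=1}^{2r}t_{ik}(z)\otimes t_{kj}(z)$ for all $1\le i,j\le 2r$.
   Context: Let $r\ge3$. $\Lambda=\bigoplus_{j=1}^{r+1}\mathbb Z\epsilon_j$ with dual basis $\epsilon_j^\vee$. $\hat\alpha_i^\vee=\epsilon_i^\vee-\epsilon_{i+1}^\vee$ ($i<r$), $\hat\alpha_r^\vee=\epsilon_{r-1}^\vee-\epsilon_{r+1}^\vee$; $\Lambda^+=\{\mu\in\Lambda:\hat\alpha_i^\vee(\mu)\ge0,\ 1\le i\le r\}$. Let $N=2r$, $\kappa=r-1$, $i'=N+1-i$, $R(z)=\mathrm{Id}+\frac{P}{z}-\frac{Q}{z+\kappa}$ with $P=\sum_{i,j}E_{ij}\otimes E_{ji}$, $Q=\sum_{i,j}E_{ij}\otimes E_{i'j'}$. For $\mu\in\Lambda^+$ let $d_j=\epsilon_j^\vee(\mu)$ and $d_i'=d_r+d_{r+1}-d_i$ ($1\le i\le r$). $X^{\mathrm{rtt}}_{-\mu}(\mathfrak{so}_{2r})$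 is the associative $\mathbb C$-algebra generated by $t_{ij}^{(k)}$ ($1\le i,j\le N$, $k\in\mathbb Z$), $t_{ij}(z)=\sum_kt_{ij}^{(k)}z^{-k}$, $T(z)=(t_{ij}(z))$, subject to the RTT relation $R_{12}(z-w)T_1(z)T_2(w)=T_2(w)T_1(z)R_{12}(z-w)$ and to the requirement that $T(z)=F(z)H(z)E(z)$ with $F(z)$ lower unitriangular with entries $f_{j,i}(z)$ ($i<j$), $H(z)=\mathrm{diag}(h_1(z),\dots,h_N(z))$, $E(z)$ upper unitriangular with entries $e_{i,j}(z)$ ($i<j$), where $e_{i,j}(z),f_{j,i}(z)$ are series in strictly negative powers of $z$, $h_i(z)=z^{d_i}+(\text{lower powers of }z)$ and $h_{i'}(z)=z^{d'_i}+(\text{lower powers of }z)$ for $1\le i\le r$. (Equivalently: generated by the coefficients of all $e_{i,j},f_{j,i},h_i$ subject to the RTT relation for $T:=FHE$.) *)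

(* Defs.v *)
From HB Require Import structures.
From mathcomp Require Import all_boot all_order all_algebra.
From mathcomp Require Import generic_quotient ring_quotient.
From mathcomp Require Import boolp classical_sets functions cardinality.
From mathcomp Require Import fsbigop reals complex monalg ring.

Set Implicit Arguments.
Unset Strict Implicit.
Unset Printing Implicit Defensive.

Import Order.TTheory GRing.Theory Num.Theory.
Local Open Scope ring_scope.
Local Open Scope quotient_scope.

(* Unital associative K-algebras, as rings A equipped with a ring morphism from
   K to the centre of A.  MathComp's algType is not used because it requires
   1 != 0, which an algebra given by generators and relations need not
   satisfy a priori. *)
HB.mixin Record PzRing_isPzAlgebra (K : comPzRingType) A of GRing.PzRing A := {
  scal : K -> A;
  scal1_subproof : scal 1 = 1;
  scalD_subproof : {morph scal : x y / x + y};
  scalM_subproof : {morph scal : x y / x * y};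
  scalC : forall (k : K) (x : A), scal k * x = x * scal k
}.

#[short(type="pzAlgType")]
HB.structure Definition PzAlgebra (K : comPzRingType) :=
  {A of PzRing_isPzAlgebra K A & GRing.PzRing A}.

Section ScalMorphism.
Variables (K : comPzRingType) (A : pzAlgType K).

Lemma scal_is_zmod_morphism : zmod_morphism (scal : K -> A).
Proof.
move=> x y; apply: (@addIr _ (scal y)).
by rewrite -scalD_subproof !subrK.
Qed.

HB.instance Definition _ := GRing.isZmodMorphism.Build K A scal
  scal_is_zmod_morphism.
HB.instance Definition _ := GRing.isMonoidMorphism.Build K A scal
  (conj scal1_subproof scalM_subproof).

End ScalMorphism.

Definition is_alg_hom (K : comPzRingType) (A B : pzAlgType K)
  (f : {rmorphism A -> B}) := forall k : K, f (scal k) = scal k.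

Section FreeAlgebra.
Variables (K : comNzRingType) (G : choiceType).

Definition freeAlg := {malg K[{fmonom G}]}.

HB.instance Definition _ := GRing.NzRing.on freeAlg.

Lemma freeAlg_scalC (k : K) (x : freeAlg) : k%:MP * x = x * k%:MP.
Proof.
rewrite [LHS]fgmulUg [RHS]fgmulgU.
by apply: eq_bigr => m _; rewrite mul1m mulm1 mulrC.
Qed.

HB.instance Definition _ := PzRing_isPzAlgebra.Build K freeAlg
  (rmorph1 (@malgC _ K)) (rmorphD (@malgC _ K)) (rmorphM (@malgC _ K))
  freeAlg_scalC.

Definition freeGen (g : G) : freeAlg := << fmu g >>%R.

End FreeAlgebra.

(* Two-sided ideal generated by a set S of elements. *)
Inductive in_ideal (A : pzRingType) (S : A -> Prop) : A -> Prop :=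
| in_ideal0 : in_ideal S 0
| in_idealD x y : in_ideal S x -> in_ideal S y -> in_ideal S (x + y)
| in_ideal_gen a s b : S s -> in_ideal S (a * s * b).

Definition genIdeal (A : pzRingType) (S : A -> Prop) : {pred A} :=
  fun x => `[< in_ideal S x >].

Section Quotient.
Variables (A : pzRingType) (S : A -> Prop).
Local Notation I := (genIdeal S).

Lemma genIdealP x : reflect (in_ideal S x) (x \in I).
Proof. exact: asboolP. Qed.

Lemma in_idealMl a x : in_ideal S x -> in_ideal S (a * x).
Proof.
elim=> [|y z _ IHy _ IHz|b s c Ss]; first by rewrite mulr0; constructor.
- by rewrite mulrDr; constructor.
- by rewrite !mulrA; constructor.
Qed.

Lemma in_idealMr a x : in_ideal S x -> in_ideal S (x * a).
Proof.
elim=> [|y z _ IHy _ IHz|b s c Ss]; first by rewrite mul0r; constructor.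
- by rewrite mulrDl; constructor.
- by rewrite -mulrA; constructor.
Qed.

Lemma genIdeal_zmod_closed : zmod_closed I.
Proof.
split=> [|x y /genIdealP Ix /genIdealP Iy]; apply/genIdealP; first constructor.
by constructor=> //; rewrite -mulN1r; apply: in_idealMl.
Qed.

HB.instance Definition _ := GRing.isZmodClosed.Build A I genIdeal_zmod_closed.

Definition idealQuot : Type := Quotient.quot I.

HB.instance Definition _ := GRing.Zmodule.on idealQuot.
HB.instance Definition _ := EqQuotient.on idealQuot.

Definition quotPi (x : A) : idealQuot := \pi_(Quotient.quot I) x.

Lemma quotPiP x y : quotPi x = quotPi y <-> in_ideal S (x - y).
Proof.
rewrite /quotPi; split=> [/eqP|/genIdealP].
  by rewrite -Quotient.idealrBE => /genIdealP.
by rewrite Quotient.idealrBE => /eqP.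
Qed.

Lemma quotPi_surj (x : idealQuot) : exists y, quotPi y = x.
Proof. by exists (repr x); rewrite /quotPi reprK. Qed.

Lemma quotPiD : {morph quotPi : x y / x + y}.
Proof. exact: Quotient.pi_add. Qed.

Definition quotOne : idealQuot := quotPi 1.
Definition quotMul (x y : idealQuot) : idealQuot := quotPi (repr x * repr y).

Lemma quotPiM x y : quotPi (x * y) = quotMul (quotPi x) (quotPi y).
Proof.
have rI z : in_ideal S (z - repr (quotPi z)).
  by apply/quotPiP; rewrite [RHS]reprK.
apply/quotPiP.
set x' := repr _; set y' := repr _.
have -> : x * y - x' * y' = (x - x') * y + x' * (y - y').
  by rewrite mulrBl mulrBr addrA subrK.
by constructor; [apply/in_idealMr/rI|apply/in_idealMl/rI].
Qed.

Lemma quotMulA : associative quotMul.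
Proof.
move=> x y z; case: (quotPi_surj x) (quotPi_surj y) (quotPi_surj z).
by move=> a <- [b <-] [c <-]; rewrite -!quotPiM mulrA.
Qed.

Lemma quotMul1r : left_id quotOne quotMul.
Proof. by move=> x; case: (quotPi_surj x) => a <-; rewrite -quotPiM mul1r. Qed.

Lemma quotMulr1 : right_id quotOne quotMul.
Proof. by move=> x; case: (quotPi_surj x) => a <-; rewrite -quotPiM mulr1. Qed.

Lemma quotMulDl : left_distributive quotMul +%R.
Proof.
move=> x y z; case: (quotPi_surj x) (quotPi_surj y) (quotPi_surj z).
by move=> a <- [b <-] [c <-]; rewrite -!(quotPiD, quotPiM) mulrDl.
Qed.

Lemma quotMulDr : right_distributive quotMul +%R.
Proof.
move=> x y z; case: (quotPi_surj x) (quotPi_surj y) (quotPi_surj z).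
by move=> a <- [b <-] [c <-]; rewrite -!(quotPiD, quotPiM) mulrDr.
Qed.

HB.instance Definition _ := GRing.Zmodule_isPzRing.Build idealQuot
  quotMulA quotMul1r quotMulr1 quotMulDl quotMulDr.

End Quotient.

Section Presentation.
Variables (K : comNzRingType) (G : choiceType) (S : freeAlg K G -> Prop).

(* The K-algebra with generators G and relations s = 0 for s in S. *)
Definition presAlg : Type := idealQuot S.

HB.instance Definition _ := GRing.PzRing.on presAlg.

Definition presPi (x : freeAlg K G) : presAlg := quotPi S x.

Lemma presPi1 : presPi 1 = 1. Proof. by []. Qed.
Lemma presPiD : {morph presPi : x y / x + y}. Proof. exact: quotPiD. Qed.
Lemma presPiM : {morph presPi : x y / x * y}. Proof. exact: quotPiM. Qed.

Definition presScal (k : K) : presAlg := presPi (scal k).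

Lemma presScal1 : presScal 1 = 1.
Proof. by rewrite /presScal rmorph1. Qed.
Lemma presScalD : {morph presScal : x y / x + y}.
Proof. by move=> x y; rewrite /presScal rmorphD presPiD. Qed.
Lemma presScalM : {morph presScal : x y / x * y}.
Proof. by move=> x y; rewrite /presScal rmorphM presPiM. Qed.
Lemma presScalC k (x : presAlg) : presScal k * x = x * presScal k.
Proof.
by case: (quotPi_surj x) => y <-; rewrite -!presPiM scalC.
Qed.

HB.instance Definition _ := PzRing_isPzAlgebra.Build K presAlg
  presScal1 presScalD presScalM presScalC.

Definition presGen (g : G) : presAlg := presPi (freeGen K g).

End Presentation.

(* The tensor product of K-algebras: the algebra spanned by the symbols
   p (a, b) = a (x) b, bilinear over K, with componentwise product and unit. *)
Inductive tens_rel (K : comNzRingType) (A B : pzAlgType K) :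
    freeAlg K (A * B)%type -> Prop :=
| tens_relDl a a' b : tens_rel
    (freeGen K (a + a', b) - (freeGen K (a, b) + freeGen K (a', b)))
| tens_relDr a b b' : tens_rel
    (freeGen K (a, b + b') - (freeGen K (a, b) + freeGen K (a, b')))
| tens_relZl k a b : tens_rel
    (freeGen K (scal k * a, b) - scal k * freeGen K (a, b))
| tens_relZr k a b : tens_rel
    (freeGen K (a, scal k * b) - scal k * freeGen K (a, b))
| tens_relM a a' b b' : tens_rel
    (freeGen K (a, b) * freeGen K (a', b') - freeGen K (a * a', b * b'))
| tens_rel1 : tens_rel (freeGen K (1, 1) - 1).

Definition tensAlg (K : comNzRingType) (A B : pzAlgType K) :=
  presAlg (@tens_rel K A B).

HB.instance Definition _ (K : comNzRingType) (A B : pzAlgType K) :=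
  PzAlgebra.on (tensAlg A B).

Definition tens (K : comNzRingType) (A B : pzAlgType K) (a : A) (b : B) :
  tensAlg A B := presGen (@tens_rel K A B) (a, b).

(* A formal series in z is the function sending a to the coefficient of z^a.
   All the series below have bounded above support, so that only finitely many
   terms of the convolution are nonzero. *)
Definition convol (A B C : pzRingType) (op : A -> B -> C)
    (f : int -> A) (g : int -> B) : int -> C :=
  fun m => \sum_(a \in [set: int]) op (f a) (g (m - a)).

Section RTT.
Variables (K : fieldType) (r : nat).

Local Notation N := (2 * r)%N.
Local Notation kappa := (r.-1%:R : K).

(* Indices 1, ..., N are represented by 0, ..., N - 1; the involution
   i' = N + 1 - i becomes rev_ord.  Operators on K^N (x) K^N are described by
   their matrix coefficients, rows and columns being pairs of indices. *)
Implicit Types x y : 'I_N * 'I_N.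

Definition Pmx x y : bool := (x.1 == y.2) && (x.2 == y.1).
Definition Qmx x y : bool := (x.2 == rev_ord x.1) && (y.2 == rev_ord y.1).

Definition Rmx (z : K) x y : K :=
  (x == y)%:R + (Pmx x y)%:R / z - (Qmx x y)%:R / (z + kappa).

(* z (z + kappa) R(z), as a polynomial in z. *)
Definition Rpoly x y : {poly K} :=
  'X * ('X + kappa%:P) * (x == y)%:R + ('X + kappa%:P) * (Pmx x y)%:R
    - 'X * (Qmx x y)%:R.

Lemma RpolyE z x y : z != 0 -> z + kappa != 0 ->
  (Rpoly x y).[z] = z * (z + kappa) * Rmx z x y.
Proof.
move=> z0 zk0; rewrite /Rpoly /Rmx !hornerE.
have hn (b : bool) : (b%:R : {poly K}).[z] = b%:R.
  by case: b; rewrite ?hornerE.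
rewrite !hn; field; exact/andP.
Qed.

Variable A : pzAlgType K.

(* Series in z and w, with coefficients indexed by the exponents of z and w. *)
Definition mulzw (s : int -> int -> A) : int -> int -> A :=
  fun a b => s (a - 1) b - s a (b - 1).

(* Product of s(z, w) by p(z - w). *)
Definition polyzw (p : {poly K}) (s : int -> int -> A) : int -> int -> A :=
  fun a b => \sum_(n < size p) scal p`_n * iter n mulzw s a b.

(* Matrix coefficients of R(z-w) T_1(z) T_2(w) and T_2(w) T_1(z) R(z-w), both
   multiplied by (z - w) (z - w + kappa). *)
Definition rttL (T : 'I_N -> 'I_N -> int -> A) x y : int -> int -> A :=
  fun a b => \sum_v
    polyzw (Rpoly x v) (fun c d => T v.1 y.1 c * T v.2 y.2 d) a b.
Definition rttR (T : 'I_N -> 'I_N -> int -> A) x y : int -> int -> A :=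
  fun a b => \sum_v
    polyzw (Rpoly v y) (fun c d => T x.2 v.2 d * T x.1 v.1 c) a b.

End RTT.

Section Coweights.
Variable r : nat.

Definition Lambda := {ffun 'I_r.+1 -> int}.

HB.instance Definition _ := GRing.Zmodule.on Lambda.

Implicit Types mu : Lambda.

(* dcoef mu j = epsilon_j^vee (mu), for 1 <= j <= r + 1. *)
Definition dcoef mu (j : nat) : int := mu (inord j.-1).

Definition coroot (i : nat) mu : int :=
  if (i < r)%N then dcoef mu i - dcoef mu i.+1
  else dcoef mu r.-1 - dcoef mu r.+1.

Definition dominant mu := forall i : nat, (1 <= i <= r)%N -> 0 <= coroot i mu.

(* Leading exponent of h_i(z): d_i for i <= r, and d'_j for i = j', j <= r. *)
Definition hdeg mu (i : 'I_(2 * r)) : int :=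
  if (i < r)%N then dcoef mu i.+1
  else dcoef mu r + dcoef mu r.+1 - dcoef mu (rev_ord i).+1.

End Coweights.

(* The generator (i, j, n) is the coefficient of z^-(n+1) in e_{i,j}(z) if i < j
   and in f_{i,j}(z) if i > j, and the coefficient of z^(D-n-1) in h_i(z), with D
   its leading exponent, if i = j. *)
Definition gen (r : nat) : Type := ('I_(2 * r) * 'I_(2 * r) * nat)%type.

HB.instance Definition _ (r : nat) := Choice.on (gen r).

Section Gauss.
Variables (r : nat) (mu : Lambda r) (A : pzRingType) (g : gen r -> A).

Local Notation N := (2 * r)%N.

Definition Eser (i j : 'I_N) : int -> A := fun a =>
  if i == j then (a == 0)%:R
  else if (i < j)%N && (a < 0) then g (i, j, `|a|.-1)%N else 0.

Definition Fser (i j : 'I_N) : int -> A := fun a =>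
  if i == j then (a == 0)%:R
  else if (j < i)%N && (a < 0) then g (i, j, `|a|.-1)%N else 0.

Definition Hser (i : 'I_N) : int -> A := fun a =>
  if a == hdeg mu i then 1
  else if a < hdeg mu i then g (i, i, `|a - hdeg mu i|.-1)%N else 0.

(* T(z) = F(z) H(z) E(z) *)
Definition Tser (i j : 'I_N) : int -> A := fun a =>
  \sum_(k < N) convol *%R (convol *%R (Fser i k) (Hser k)) (Eser k j) a.

End Gauss.

Section Xrtt.
Variables (K : fieldType) (r : nat) (mu : Lambda r).

Inductive rtt_rel : freeAlg K (gen r) -> Prop :=
| Rtt_rel x y a b (T := Tser mu (freeGen K (G := gen r))) :
    rtt_rel (rttL T x y a b - rttR T x y a b).

Definition Xrtt := presAlg rtt_rel.

HB.instance Definition _ := PzAlgebra.on Xrtt.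

Definition Xgen : gen r -> Xrtt := presGen rtt_rel.

(* The series t_{ij}(z); the generator t_{ij}^(k) is tser i j (- k). *)
Definition tser (i j : 'I_(2 * r)) : int -> Xrtt := Tser mu Xgen i j.

End Xrtt.

(* t_{ij}(z) |-> \sum_k t_{ik}(z) (x) t_{kj}(z), coefficientwise. *)
Definition maps_T_to_TT (K : fieldType) (r : nat) (mu1 mu2 : Lambda r)
    (f : Xrtt K (mu1 + mu2) -> tensAlg (Xrtt K mu1) (Xrtt K mu2)) : Prop :=
  forall (i j : 'I_(2 * r)) (m : int),
    f (tser K (mu1 + mu2) i j m) =
    \sum_(k < 2 * r)
      convol (@tens K _ _) (tser K mu1 i k) (tser K mu2 k j) m.

(* Main.v *)
Require Import Defs.
From HB Require Import structures.
From mathcomp Require Import all_boot all_order all_algebra all_fingroup.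
From mathcomp Require Import generic_quotient ring_quotient finmap monalg.
From mathcomp Require Import boolp classical_sets fsbigop reals complex.
From mathcomp Require Import zify ring.

Set Implicit Arguments.
Unset Strict Implicit.
Unset Printing Implicit Defensive.

Import Order.TTheory GRing.Theory Num.Theory.
Local Open Scope ring_scope.

(** The product T = T1 T2 of the generating matrices of the two tensor factors
    satisfies the RTT relation, because the entries of T1 commute with those of
    T2 (lrtt_mul).  The point is that T has a Gauss decomposition of the shape
    prescribed for mu1 + mu2.

    Let T1 = F1 H1 E1 and T2 = F2 H2 E2.  The middle product E1 F2 is
    1 + O(z^-1), hence equals F' H' E' with three factors of the form
    1 + O(z^-1) (gauss_near1), and T = F H E for
      F = F1 (H1 F' H1^-1),   H = H1 H' H2,   E = (H2^-1 E' H2) E2.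
    Below the diagonal the entry (i, j) of H1 F' H1^-1 has degree at most
    d_i - d_j - 1, and dominance says that the leading exponents d_1, ..., d_N
    of the h_i decrease weakly, except that it does not compare the positions r and r + 1
    (hdeg_nonincreasing).  So the degrees are right away from the positions
    (r, r + 1) of E and (r + 1, r) of F (shifted_gauss_mul).

    In these two positions the factors vanish, for every matrix T that satisfies
    RTT and has a Gauss decomposition with monic h_i, whatever the degrees
    (upper_corner, lower_corner).  Let D(u) and D'(u) be the quantum minors of T
    on the rows 1, ..., r and on the columns 1, ..., r, respectively
    1, ..., r - 1, r + 1.  The value z - w = -1 of the RTT relation makes quantum
    minors antisymmetric in their columns as long as no two columns j, j' occur
    together (rtt_anti).  The value z - w = - kappa gives
      sum_p t_{k p'}(u + kappa) t_{i p}(u) = 0   for k != i'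
    (rtt_orthogonal).  Multiplying by the cofactors of the expansion of minors
    along the last column on the left, and along the first column on the right,
    and summing over k and i, only p = r and p = r + 1 survive, and
      D'(u) D(u) + D(u) D'(u) = 0.
    The Gauss decomposition gives D(u) = h_1(u) h_2(u + 1) ... h_r(u + r - 1) and
    D'(u) = D(u) e_{r,r+1}(u + r - 1) (gauss_minor).  As D is monic, twice the
    leading coefficient of e_{r,r+1} is zero, so e_{r,r+1} = 0.  Transposing T
    and reversing the multiplication of the algebra gives f_{r+1,r} = 0.

    A homomorphism out of a shifted algebra is therefore the same thing as a
    matrix with RTT and a Gauss decomposition of the right shape
    (Xrtt_universal); it is determined by the images of the t_ij because Gauss
    factors are unique (gauss_unique). *)

(** * Laurent series in z^-1 *)

Definition deg_le (V : zmodType) (p : int) (f : int -> V) :=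
  forall m, p < m -> f m = 0.

Lemma deg_le_widen (V : zmodType) p q (f : int -> V) :
  p <= q -> deg_le p f -> deg_le q f.
Proof. by move=> pq fp m qminor; apply: fp; apply: le_lt_trans qminor. Qed.

Lemma fsum_int (V : zmodType) (F : int -> V) (p : int) (n : nat) :
  deg_le p F -> (forall m, m <= p - n%:Z -> F m = 0) ->
  \sum_(a \in [set: int]) F a = \sum_(i < n) F (p - i%:Z).
Proof.
move=> Fp Fn; rewrite (@fsbigE _ _ _ _ _ [seq p - i%:Z | i <- iota 0 n]) //.
- rewrite (eq_bigl xpredT) => [|i]; rewrite ?in_setT // big_map.
  by rewrite -(big_mkord xpredT (fun i => F (p - i%:Z))) /index_iota subn0.
- by rewrite map_inj_in_uniq ?iota_uniq // => i j _ _ ; lia.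
- move=> m _ mr; case: (ltP p m) => [/Fp //|mp].
  apply: Fn; rewrite leNgt; apply: contraNN mr => mn.
  apply/mapP; exists (absz (p - m)%R); last by lia.
  by rewrite mem_iota; lia.
Qed.

Lemma lt_natz (x : int) : exists n : nat, x < n%:Z.
Proof. by exists (absz x).+1; lia. Qed.

Section Laurent.
Variable A : pzRingType.

(** Series in z with exponents bounded above, over a ring in which 1 = 0 is
    allowed; they are kept as functions of the exponent, so that the product is
    the convolution that defines the matrix T. *)
Record laurent := Laurent {
  lcoef :> int -> A;
  lcoef_bounded : exists p, deg_le p lcoef }.

HB.instance Definition _ := gen_eqMixin laurent.
HB.instance Definition _ := gen_choiceMixin laurent.

Implicit Types (f g h : laurent) (p q m : int).

Lemma laurentP f g : (forall m, f m = g m) -> f = g.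
Proof.
case: f g => [f Pf] [g Pg] /= /funext fg.
by case: _ / fg Pg => Pg; congr Laurent; apply: Prop_irrelevance.
Qed.

Lemma ldeg2 f g : exists p, deg_le p f /\ deg_le p g.
Proof.
case: (lcoef_bounded f) (lcoef_bounded g) => p fp [q gq].
exists (Num.max p q); split.
  by apply: deg_le_widen fp; rewrite le_max lexx.
by apply: deg_le_widen gq; rewrite le_max lexx orbT.
Qed.

Lemma lzero_bounded : exists p, deg_le p (fun=> 0 : A).
Proof. by exists 0. Qed.
Lemma lopp_bounded f : exists p, deg_le p (fun m => - f m).
Proof. by case: (lcoef_bounded f) => p fp; exists p => m /fp ->; rewrite oppr0. Qed.
Lemma ladd_bounded f g : exists p, deg_le p (fun m => f m + g m).
Proof.
case: (ldeg2 f g) => p [fp gp]; exists p => m pm.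
by rewrite fp // gp // addr0.
Qed.

Definition lzero := Laurent lzero_bounded.
Definition lopp f := Laurent (lopp_bounded f).
Definition ladd f g := Laurent (ladd_bounded f g).

Lemma laddA : associative ladd.
Proof. by move=> f g h; apply: laurentP => m /=; rewrite addrA. Qed.
Lemma laddC : commutative ladd.
Proof. by move=> f g; apply: laurentP => m /=; rewrite addrC. Qed.
Lemma ladd0 : left_id lzero ladd.
Proof. by move=> f; apply: laurentP => m /=; rewrite add0r. Qed.
Lemma laddN : left_inverse lzero lopp ladd.
Proof. by move=> f; apply: laurentP => m /=; rewrite addNr. Qed.

HB.instance Definition _ := GRing.isZmodule.Build laurent laddA laddC ladd0 laddN.

(** The support of a |-> f a * g (m - a) is contained in the interval
    [m - q, p]. *)
Lemma convolE p q m (n : nat) (f g : int -> A) : deg_le p f -> deg_le q g ->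
  p + q - m < n%:Z ->
  convol *%R f g m = \sum_(i < n) f (p - i%:Z) * g (m - (p - i%:Z)).
Proof.
move=> fp gq nm; rewrite /convol (@fsum_int _ _ p n) //.
- by move=> a pa; rewrite fp ?mul0r.
- by move=> a an; rewrite gq ?mulr0 //; lia.
Qed.

Lemma deg_le_convol p q (f g : int -> A) : deg_le p f -> deg_le q g ->
  deg_le (p + q) (convol *%R f g).
Proof. by move=> fp gq m pqm; rewrite (convolE (n := 0) fp gq) ?big_ord0 //; lia. Qed.

Lemma lmul_bounded f g : exists p, deg_le p (convol *%R f g).
Proof.
by case: (ldeg2 f g) => p [fp gp]; exists (p + p); apply: deg_le_convol.
Qed.
Definition lmul f g := Laurent (lmul_bounded f g).

Lemma delta_bounded (a : A) d : exists p, deg_le p (fun m => if m == d then a else 0).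
Proof. by exists d => m dm; rewrite gt_eqF. Qed.
Definition lmon (a : A) d := Laurent (delta_bounded a d).

Lemma lmulA : associative lmul.
Proof.
move=> f g h; apply: laurentP => m /=.
case: (lcoef_bounded f) (lcoef_bounded g) (lcoef_bounded h) => p fp [q gq] [s hs].
have gh := deg_le_convol gq hs; have fg := deg_le_convol fp gq.
have [n nE] := lt_natz (p + (q + s) - m).
rewrite (convolE (n := n) fp gh) 1?(convolE (n := n) fg hs); try lia.
under eq_bigr => i _.
  rewrite (convolE (n := n) gq hs); last by lia.
  rewrite mulr_sumr; over.
under [RHS]eq_bigr => i _.
  rewrite (convolE (n := n) fp gq); last by have := ltn_ord i; lia.
  rewrite mulr_suml; over.
rewrite [RHS]exchange_big /=; apply: eq_bigr => i _.
(* shift the inner index by i: the terms left over vanish *)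
pose G (k : int) := f (p - i%:Z) * (g (q - k) * h (m - (p - i%:Z) - (q - k))).
transitivity (\sum_(0 <= j < n) G j%:Z); first by rewrite big_mkord.
transitivity (\sum_(0 <= j < n) G (j%:Z - i%:Z)); last first.
  rewrite big_mkord; apply: eq_bigr => j _; rewrite /G -mulrA.
  by congr (_ * (g _ * h _)); lia.
have lein : (i <= n)%N by rewrite ltnW.
rewrite (big_cat_nat (n := n - i)) ?leq_subr //=.
rewrite [X in _ + X]big_nat [X in _ + X]big1 => [|j jn]; last first.
  by rewrite /G hs ?mulr0 //; lia.
rewrite addr0 [RHS](big_cat_nat (n := i)) //=.
rewrite [X in _ = X + _]big_nat [X in _ = X + _]big1 => [|j jn]; last first.
  by rewrite /G gq ?(mul0r, mulr0) //; lia.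
rewrite add0r -{2}(add0n (nat_of_ord i)) big_addn; apply: eq_bigr => j _.
by congr G; lia.
Qed.

Lemma lmon_mulE a d f m : lmul (lmon a d) f m = a * f (m - d).
Proof.
case: (lcoef_bounded f) => p fp /=.
rewrite (@convolE d p m ((absz (d + p - m)%R).+1) _ _ _ fp); try lia.
  rewrite big_ord_recl /= subr0 eqxx big1 ?addr0 // => i _.
  by rewrite (_ : _ == _ = false) ?mul0r //; apply/eqP; rewrite /bump /=; lia.
by move=> k dk; rewrite gt_eqF.
Qed.

Lemma lmul_monE a d f m : lmul f (lmon a d) m = f (m - d) * a.
Proof.
case: (lcoef_bounded f) => p fp /=.
have [mp|pm] := leP (m - d) p; last first.
  rewrite (@convolE p d m 0 _ _ fp); try lia.
    by rewrite big_ord0 fp ?mul0r //; lia.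
  by move=> k dk; rewrite gt_eqF.
rewrite (@convolE p d m ((absz (p - m + d)%R).+1) _ _ fp); try lia.
  rewrite big_ord_recr /= big1 ?add0r.
    have -> : p - (absz (p - m + d)%R)%:Z = m - d by lia.
    by rewrite subKr eqxx.
  move=> i _.
  rewrite (_ : _ == _ = false) ?mulr0 //; apply/eqP.
  have := ltn_ord i; lia.
by move=> k dk; rewrite gt_eqF.
Qed.

Lemma lmul1 : left_id (lmon 1 0) lmul.
Proof. by move=> f; apply: laurentP => m; rewrite lmon_mulE subr0 mul1r. Qed.
Lemma lmulr1 : right_id (lmon 1 0) lmul.
Proof. by move=> f; apply: laurentP => m; rewrite lmul_monE subr0 mulr1. Qed.

Lemma lmulDl : left_distributive lmul ladd.
Proof.
move=> f g h; apply: laurentP => m /=.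
case: (ldeg2 f g) (lcoef_bounded h) => p [fp gp] [q hq].
have fgp : deg_le p (ladd f g) by move=> k pk /=; rewrite fp // gp // addr0.
have [n nE] := lt_natz (p + q - m).
rewrite (convolE (n := n) fgp hq) 1?(convolE (n := n) fp hq)
   1?(convolE (n := n) gp hq) ; try lia.
by rewrite -big_split; apply: eq_bigr => i _; rewrite mulrDl.
Qed.
Lemma lmulDr : right_distributive lmul ladd.
Proof.
move=> h f g; apply: laurentP => m /=.
case: (ldeg2 f g) (lcoef_bounded h) => p [fp gp] [q hq].
have fgp : deg_le p (ladd f g) by move=> k pk /=; rewrite fp // gp // addr0.
have [n nE] := lt_natz (p + q - m).
rewrite (convolE (n := n) hq fgp) 1?(convolE (n := n) hq fp)
   1?(convolE (n := n) hq gp) ; try lia.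
by rewrite -big_split; apply: eq_bigr => i _; rewrite mulrDr.
Qed.

HB.instance Definition _ := GRing.Zmodule_isPzRing.Build laurent
  lmulA lmul1 lmulr1 lmulDl lmulDr.

Lemma lcoefD f g m : (f + g) m = f m + g m. Proof. by []. Qed.
Lemma lcoefN f m : (- f) m = - f m. Proof. by []. Qed.
Lemma lcoef_sum I (r : seq I) (P : pred I) (F : I -> laurent) m :
  (\sum_(i <- r | P i) F i) m = \sum_(i <- r | P i) F i m.
Proof. by elim/big_rec2: _ => // i x y _ <-. Qed.
Lemma lcoefM f g m : (f * g) m = convol *%R f g m. Proof. by []. Qed.
Lemma lmonM a d f m : (lmon a d * f) m = a * f (m - d).
Proof. exact: lmon_mulE. Qed.
Lemma lMmon a d f m : (f * lmon a d) m = f (m - d) * a.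
Proof. exact: lmul_monE. Qed.
Lemma lmonE a d m : lmon a d m = if m == d then a else 0. Proof. by []. Qed.
Lemma lone m : (1 : laurent) m = (m == 0)%:R.
Proof. by rewrite [LHS]lmonE; case: eqP. Qed.

Lemma lmon_monM a b d e : lmon a d * lmon b e = lmon (a * b) (d + e).
Proof.
apply: laurentP => m; rewrite lmonM !lmonE subr_eq (addrC e).
by case: eqP; rewrite ?mulr0.
Qed.

Lemma degD p f g : deg_le p f -> deg_le p g -> deg_le p (f + g).
Proof. by move=> fp gp m pm; rewrite lcoefD fp // gp // addr0. Qed.
Lemma degN p f : deg_le p f -> deg_le p (- f).
Proof. by move=> fp m pm; rewrite lcoefN fp // oppr0. Qed.
Lemma deg_sum p I (r : seq I) (P : pred I) (F : I -> laurent) :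
  (forall i, P i -> deg_le p (F i)) -> deg_le p (\sum_(i <- r | P i) F i).
Proof.
by move=> Fp m pm; rewrite lcoef_sum big1 // => i Pi; apply: Fp.
Qed.
Lemma degM p q f g : deg_le p f -> deg_le q g -> deg_le (p + q) (f * g).
Proof. exact: deg_le_convol. Qed.
Lemma degM_le p q s f g : deg_le p f -> deg_le q g -> p + q <= s ->
  deg_le s (f * g).
Proof. by move=> fp gq pqs; apply: deg_le_widen pqs (degM fp gq). Qed.
Lemma deg_mon a d : deg_le d (lmon a d).
Proof. by move=> m dm; rewrite lmonE gt_eqF. Qed.
Lemma deg1 : deg_le 0 (1 : laurent). Proof. exact: deg_mon. Qed.
Lemma lead_mul p q f g : deg_le p f -> deg_le q g -> (f * g) (p + q) = f p * g q.
Proof.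
move=> fp gq; rewrite lcoefM (convolE (n := 1) fp gq); last by lia.
by rewrite big_ord1 subr0 addrAC subrr add0r.
Qed.
Lemma degX p f n : deg_le p f -> deg_le (p *+ n) (f ^+ n).
Proof.
move=> fp; elim: n => [|n IHn]; first exact: deg1.
by rewrite exprS mulrS; apply: degM.
Qed.

Lemma lcoefMn p q f g (n : nat) : deg_le p f -> deg_le q g ->
  (f * g) (p + q - n%:Z) = \sum_(i < n.+1) f (p - i%:Z) * g (q - (n - i)%N%:Z).
Proof.
move=> fp gq; rewrite lcoefM (convolE (n := n.+1) fp gq); last by lia.
by apply: eq_bigr => i _; congr (_ * g _); have := ltn_ord i; lia.
Qed.

(** Sum of a family u 0, u 1, ... such that u i has degree at most p - i: only
    the terms with i <= p - m contribute to the coefficient of z^m. *)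
Definition lsum_fun p (u : nat -> laurent) : int -> A := fun m =>
  if m <= p then \sum_(i < (absz (p - m)%R).+1) u i m else 0.
Lemma lsum_bounded p u : exists q, deg_le q (lsum_fun p u).
Proof. by exists p => m pm; rewrite /lsum_fun leNgt pm. Qed.
Definition lsum p u := Laurent (lsum_bounded p u).

Definition summable p (u : nat -> laurent) := forall i, deg_le (p - i%:Z) (u i).

Lemma lsumE p u m (n : nat) : summable p u -> p - m < n%:Z ->
  lsum p u m = \sum_(i < n) u i m.
Proof.
move=> up mn; rewrite /= /lsum_fun; have [mp|pm] := leP m p; last first.
  by rewrite big1 // => i _; apply: up; lia.
rewrite -!(big_mkord xpredT (fun i => u i m)).
rewrite [RHS](big_cat_nat (n := (absz (p - m)%R).+1)) //=; try lia.
rewrite [X in _ = _ + X]big_nat [X in _ = _ + X]big1 ?addr0 // => i ii.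
by apply: up; lia.
Qed.

Lemma deg_lsum p u : deg_le p (lsum p u).
Proof. by move=> m pm; rewrite /= /lsum_fun leNgt pm. Qed.

Lemma eq_lsum p u v : (forall i, u i = v i) -> lsum p u = lsum p v.
Proof. by move=> uv; congr lsum; apply/funext. Qed.

Lemma summable_widen p q u : p <= q -> summable p u -> summable q u.
Proof. by move=> pq up i; apply: deg_le_widen (up i); rewrite lerD2r. Qed.

Lemma lsum_widen p q u : p <= q -> summable p u -> lsum q u = lsum p u.
Proof.
move=> pq up; apply: laurentP => m.
have uq := summable_widen pq up.
by rewrite !(@lsumE _ _ _ ((absz (q - m)%R) + (absz (p - m)%R)).+1) //; lia.
Qed.

Lemma lsumD p u v : summable p u -> summable p v ->
  lsum p u + lsum p v = lsum p (fun i => u i + v i).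
Proof.
move=> up vp; apply: laurentP => m.
rewrite lcoefD !(@lsumE _ _ _ ((absz (p - m)%R)).+1) //; try lia.
  by rewrite -big_split.
by move=> i; apply: degD.
Qed.

Lemma summable_mulr p q u g : summable p u -> deg_le q g ->
  summable (p + q) (fun i => u i * g).
Proof. by move=> up gq i; apply: degM_le (up i) gq _; lia. Qed.
Lemma summable_mull p q u g : summable p u -> deg_le q g ->
  summable (p + q) (fun i => g * u i).
Proof. by move=> up gq i; apply: degM_le gq (up i) _; lia. Qed.

Lemma lsum_mulr p q u g : summable p u -> deg_le q g ->
  lsum p u * g = lsum (p + q) (fun i => u i * g).
Proof.
move=> up gq; apply: laurentP => m.
have [n nE] := lt_natz (p + q - m).
rewrite (@lsumE _ _ _ n); [|exact: summable_mulr|lia].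
rewrite lcoefM (convolE (n := n) (deg_lsum u) gq); last by lia.
under [RHS]eq_bigr => i _.
  have ui : deg_le p (u i) by apply: deg_le_widen (up i); lia.
  rewrite lcoefM (convolE (n := n) ui gq); last by lia.
  over.
rewrite [RHS]exchange_big /=; apply: eq_bigr => j _.
rewrite -[lsum_fun _ _ _]/(lsum p u _) (@lsumE _ _ _ n) //; last by have := ltn_ord j; lia.
by rewrite mulr_suml.
Qed.

Lemma lsum_mull p q u g : summable p u -> deg_le q g ->
  g * lsum p u = lsum (p + q) (fun i => g * u i).
Proof.
move=> up gq; apply: laurentP => m.
have [n nE] := lt_natz (p + q - m).
rewrite (@lsumE _ _ _ n); [|exact: summable_mull|lia].
rewrite lcoefM (convolE (n := n) gq (deg_lsum u)); last by lia.
under [RHS]eq_bigr => i _.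
  have ui : deg_le p (u i) by apply: deg_le_widen (up i); lia.
  rewrite lcoefM (convolE (n := n) gq ui); last by lia.
  over.
rewrite [RHS]exchange_big /=; apply: eq_bigr => j _.
rewrite -[lsum_fun _ _ _]/(lsum p u _).
case: (ltP (p) (m - (q - j%:Z))) => mj.
  rewrite deg_lsum ?mulr0 //.
  by rewrite big1 // => i _; rewrite (up i) ?mulr0 //; lia.
rewrite (@lsumE _ _ _ n) //; last by have := ltn_ord j; lia.
by rewrite mulr_sumr.
Qed.

Lemma lsum_recl p u : summable p u ->
  lsum p u = u 0%N + lsum (p - 1) (fun i => u i.+1).
Proof.
move=> up; apply: laurentP => m; rewrite lcoefD.
rewrite (@lsumE _ _ _ ((absz (p - m)%R).+2)) //
  ?(@lsumE _ _ _ ((absz (p - m)%R).+1)) //; try lia.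
  by rewrite big_ord_recl.
by move=> i; apply: deg_le_widen (up i.+1); lia.
Qed.

(** Both sides sum u i j over all i and j; on the right the terms are grouped
    by i + j, as in a product of two series. *)
Lemma lsum_cauchy p (u : nat -> nat -> laurent) :
  (forall i j, deg_le (p - i%:Z - j%:Z) (u i j)) ->
  lsum p (fun i => lsum (p - i%:Z) (u i)) =
  lsum p (fun n => \sum_(i < n.+1) u i (n - i)%N).
Proof.
move=> up; apply: laurentP => m; have [n nE] := lt_natz (p - m).
have s1 : summable p (fun i => lsum (p - i%:Z) (u i)).
  by move=> i; apply: deg_lsum.
have s2 : summable p (fun n => \sum_(i < n.+1) u i (n - i)%N).
  move=> k; apply: deg_sum => i _; apply: deg_le_widen (up _ _).
  by have := ltn_ord i; lia.
rewrite (lsumE s1 nE) (lsumE s2 nE).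
under eq_bigr => i _.
  rewrite (@lsumE _ _ _ n); [|exact: up|lia].
  over.
under [RHS]eq_bigr => k _ do rewrite lcoef_sum.
pose G (k i : nat) := if (i <= k)%N then u i (k - i)%N m else 0.
transitivity (\sum_(k < n) \sum_(i < n) G k i); last first.
  apply: eq_bigr => k _; rewrite /G -big_mkcond.
  rewrite -(big_mkord (fun i => i <= k)%N (fun i => u i (k - i)%N m)).
  rewrite -(big_mkord xpredT (fun i => u i (k - i)%N m)).
  by rewrite [RHS](big_nat_widen _ _ _ _ _ (ltn_ord k)).
rewrite [RHS]exchange_big /=; apply: eq_bigr => i _.
rewrite -(big_mkord xpredT (fun j => u i j m)).
rewrite -(big_mkord xpredT (fun k => G k i)).
rewrite [RHS](big_cat_nat (n := i)) //=; last exact: ltnW.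
rewrite [X in _ = X + _]big_nat [X in _ = X + _]big1 ?add0r; last first.
  by move=> j ji; rewrite /G ifN //; lia.
rewrite -{2}(add0n (nat_of_ord i)) big_addn.
rewrite (big_cat_nat (n := n - i)) ?leq_subr //=.
rewrite [X in _ + X]big_nat [X in _ + X]big1 ?addr0; last first.
  by move=> j ji; apply: up; lia.
by apply: eq_bigr => j _; rewrite /G leq_addl addnK.
Qed.

Definition lmonic d f := deg_le d f /\ f d = 1.

Lemma lmonicM d e f g : lmonic d f -> lmonic e g -> lmonic (d + e) (f * g).
Proof.
move=> [fd f1] [ge g1]; split; first exact: degM.
by rewrite lead_mul // f1 g1 mulr1.
Qed.
Lemma lmonic1 : lmonic 0 1. Proof. by split; [exact: deg1|rewrite lone]. Qed.

(** The geometric series. *)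
Lemma geom_inv (n : laurent) : deg_le (-1) n ->
  (1 - n) * lsum 0 (fun i => n ^+ i) = 1 /\ lsum 0 (fun i => n ^+ i) * (1 - n) = 1.
Proof.
move=> n1.
have s0 : summable 0 (fun i => n ^+ i).
  by move=> i; apply: deg_le_widen (degX n1); rewrite mulNrn natz; lia.
have e := lsum_recl s0.
rewrite mulrBl mulrBr mul1r mulr1.
rewrite (lsum_mull s0 n1) (lsum_mulr s0 n1) [X in X - _]e expr0 add0r.
split.
  rewrite [X in _ - X](@eq_lsum _ _ (fun i => n ^+ i.+1)) ?addrK // => i.
  by rewrite exprS.
rewrite [X in _ - X](@eq_lsum _ _ (fun i => n ^+ i.+1)); last by move=> i; rewrite exprSr.
by rewrite [X in X - _]e expr0 addrK.
Qed.

(** A monic series of degree d is z^d (1 - n) with n of negative degree. *)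
Lemma lmonic_inv d f : lmonic d f ->
  exists g, [/\ lmonic (- d) g, f * g = 1 & g * f = 1].
Proof.
move=> [fd f1].
pose n := 1 - lmon 1 (- d) * f.
have n1 : deg_le (-1) n.
  move=> m m1; rewrite /n lcoefD lcoefN lmonM mul1r opprK lone.
  have [->|m0] := eqVneq m 0; first by rewrite add0r f1 subrr.
  by rewrite fd ?subr0 //; lia.
have fE : f = lmon 1 d * (1 - n).
  rewrite /n subKr mulrA lmon_monM mulr1 subrr.
  by rewrite [lmon 1 0 * f]mul1r.
case: (geom_inv n1); set s := lsum _ _ => ns sn.
exists (s * lmon 1 (- d)); split.
- have sd : deg_le 0 s by apply: deg_lsum.
  split; first by apply: (degM_le sd (@deg_mon 1 (- d))); rewrite add0r.
  rewrite lMmon subrr mulr1 (@lsumE _ _ _ 1) //.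
  + by rewrite big_ord1 expr0 lone.
  + by move=> i; apply: deg_le_widen (degX n1); rewrite mulNrn natz; lia.
- rewrite fE mulrA -[_ * _ * s]mulrA ns mulr1 lmon_monM mulr1 subrr; exact: erefl.
- rewrite [in LHS]fE -mulrA [lmon 1 (- d) * _]mulrA lmon_monM mulr1 addNr.
  by rewrite [lmon 1 0 * _]mul1r.
Qed.

End Laurent.

(** * Change of coefficients and scalars *)

Section Lmap.
Variables (A B : pzRingType) (phi : {rmorphism A -> B}).

Lemma lmap_bounded (f : laurent A) : exists p, deg_le p (fun m => phi (f m)).
Proof. by case: (lcoef_bounded f) => p fp; exists p => m /fp ->; rewrite rmorph0. Qed.
Definition lmap f := Laurent (lmap_bounded f).

Lemma deg_lmap p (f : laurent A) : deg_le p f -> deg_le p (lmap f).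
Proof. by move=> fp m pm; rewrite /= fp ?rmorph0. Qed.

Lemma lmap_zmod : zmod_morphism lmap.
Proof. by move=> f g; apply: laurentP => m; rewrite /= rmorphB. Qed.
Lemma lmap_monoid : monoid_morphism lmap.
Proof.
split=> [|f g]; apply: laurentP => m.
  by rewrite -[LHS]/(phi ((1 : laurent A) m)) !lone rmorph_nat.
case: (lcoef_bounded f) (lcoef_bounded g) => p fp [q gq].
have [n nE] := lt_natz (p + q - m).
rewrite [LHS]/= (convolE fp gq nE) lcoefM.
rewrite (convolE (deg_lmap fp) (deg_lmap gq) nE) rmorph_sum.
by apply: eq_bigr => i _; rewrite rmorphM.
Qed.
HB.instance Definition _ := GRing.isZmodMorphism.Build _ _ lmap lmap_zmod.
HB.instance Definition _ := GRing.isMonoidMorphism.Build _ _ lmap lmap_monoid.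
End Lmap.

Section Const.
Variable A : pzRingType.
Definition lconst (a : A) := lmon a 0.
Lemma lconst_zmod : zmod_morphism lconst.
Proof.
by move=> a b; apply: laurentP => m; rewrite lcoefD lcoefN !lmonE; case: eqP; rewrite ?subr0.
Qed.
Lemma lconst_monoid : monoid_morphism lconst.
Proof. by split=> // a b; rewrite /lconst lmon_monM addr0. Qed.
HB.instance Definition _ := GRing.isZmodMorphism.Build _ _ lconst lconst_zmod.
HB.instance Definition _ := GRing.isMonoidMorphism.Build _ _ lconst lconst_monoid.
Lemma deg_const a : deg_le 0 (lconst a). Proof. exact: deg_mon. Qed.
Implicit Types f : laurent A.
Lemma lconstM a f m : (lconst a * f) m = a * f m.
Proof. by rewrite lmonM subr0. Qed.
Lemma lMconst a f m : (f * lconst a) m = f m * a.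
Proof. by rewrite lMmon subr0. Qed.
Lemma lvarC d f : lmon 1 d * f = f * lmon 1 d.
Proof. by apply: laurentP => m; rewrite lmonM lMmon mul1r mulr1. Qed.
End Const.

Section LaurentAlg.
Variables (K : comPzRingType) (A : pzAlgType K).
Definition lscal (k : K) : laurent A := lconst (scal k).
Lemma lscal1 : lscal 1 = 1. Proof. by rewrite /lscal !rmorph1. Qed.
Lemma lscalD : {morph lscal : x y / x + y}.
Proof. by move=> x y; rewrite /lscal !rmorphD. Qed.
Lemma lscalM : {morph lscal : x y / x * y}.
Proof. by move=> x y; rewrite /lscal !rmorphM. Qed.
Lemma lscalC k (x : laurent A) : lscal k * x = x * lscal k.
Proof. by apply: laurentP => m; rewrite lmonM lMmon scalC. Qed.
HB.instance Definition _ := PzRing_isPzAlgebra.Build K (laurent A)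
  lscal1 lscalD lscalM lscalC.
End LaurentAlg.

(** * The substitution z |-> z + alpha *)

Section Shift.
Variables (K : comPzRingType) (A : pzAlgType K).
Local Notation L := (laurent A).
Implicit Types (f g : L) (p q : int) (al be : K).

(** The linear polynomial z + al.  It is monic, hence has powers with arbitrary
    integer exponents in the Laurent series. *)
Definition zplus al : L := lmon 1 1 + scal al.

Lemma lmonic_zplus al : lmonic 1 (zplus al).
Proof.
split=> [|]; last by rewrite lcoefD lmonE addr0.
by apply: degD (@deg_mon _ _ _) _; apply: deg_le_widen (@deg_const _ _).
Qed.
Definition zplusV al : L := sval (cid (lmonic_inv (lmonic_zplus al))).
Lemma zplusVP al : [/\ lmonic (- 1) (zplusV al), zplus al * zplusV al = 1
   & zplusV al * zplus al = 1].
Proof. exact: svalP (cid (lmonic_inv (lmonic_zplus al))). Qed.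

Definition zplusX al (a : int) : L :=
  match a with Posz n => zplus al ^+ n | Negz n => zplusV al ^+ n.+1 end.

Lemma lmonicX d f n : lmonic d f -> lmonic (d *+ n) (f ^+ n).
Proof.
move=> fd; elim: n => [|n IHn]; first exact: lmonic1.
by rewrite exprS mulrS; apply: lmonicM.
Qed.

Lemma lmonic_zplusX al a : lmonic a (zplusX al a).
Proof.
case: a => n /=; first by have := lmonicX n (lmonic_zplus al); rewrite natz.
have [yi _ _] := zplusVP al.
by have := lmonicX n.+1 yi; rewrite mulNrn natz NegzE.
Qed.

Lemma deg_zplusX al a : deg_le a (zplusX al a). Proof. by case: (lmonic_zplusX al a). Qed.

Lemma zplusXS al a : zplusX al (a + 1) = zplus al * zplusX al a.
Proof.
case: a => n; first by rewrite -PoszD addn1 /= exprS.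
have [_ yi _] := zplusVP al.
case: n => [|n].
  by rewrite /= expr1 yi expr0.
rewrite (_ : Negz n.+1 + 1 = Negz n); last by lia.
by rewrite /= [in RHS]exprS mulrA yi mul1r.
Qed.

Lemma zplusC al f : zplus al * f = f * zplus al.
Proof.
rewrite mulrDl mulrDr scalC; congr (_ + _).
by apply: laurentP => m; rewrite lmonM lMmon mulr1 mul1r.
Qed.
Lemma zplusXB al a : zplusX al (a - 1) = zplusV al * zplusX al a.
Proof.
have [_ _ yi] := zplusVP al.
by rewrite -{2}(subrK 1 a) zplusXS mulrA yi mul1r.
Qed.

Lemma zplusXD al a b : zplusX al (a + b) = zplusX al a * zplusX al b.
Proof.
elim/int_ind: a => [|n IH|n IH]; first by rewrite add0r mul1r.
  by rewrite -addn1 PoszD addrAC !zplusXS IH mulrA.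
rewrite (_ : - n.+1%:Z = - n%:Z - 1) ?zplusXB; last by lia.
by rewrite addrAC zplusXB IH mulrA.
Qed.

Lemma zplusVC al f : zplusV al * f = f * zplusV al.
Proof.
have [_ y1 y2] := zplusVP al.
by rewrite -[RHS]mul1r -y2 -mulrA [zplus al * _]mulrA zplusC -!mulrA y1 mulr1.
Qed.
Lemma zplusXC al a f : zplusX al a * f = f * zplusX al a.
Proof.
elim/int_ind: a => [|n IH|n IH]; first by rewrite mul1r mulr1.
  by rewrite -addn1 PoszD zplusXS -mulrA IH mulrA zplusC mulrA.
rewrite (_ : - n.+1%:Z = - n%:Z - 1) ?zplusXB; last by lia.
by rewrite -mulrA IH mulrA zplusVC mulrA.
Qed.

(** Sum over all integers a <= p of series s a of degree at most a + q.  The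
    value does not depend on the bounds p and q (isum_indep). *)
Definition isum p q (s : int -> L) : L := lsum (p + q) (fun i => s (p - i%:Z)).
Definition isummable p q (s : int -> L) :=
  (forall a, p < a -> s a = 0) /\ (forall a, deg_le (a + q) (s a)).

Lemma isummable_sum p q s : isummable p q s ->
  summable (p + q) (fun i => s (p - i%:Z)).
Proof. by case=> _ sq i; apply: deg_le_widen (sq _); lia. Qed.

Lemma isummable_widen p q p' q' s : p <= p' -> q <= q' ->
  isummable p q s -> isummable p' q' s.
Proof.
move=> pp' qq' [sp sq]; split=> a.
  by move=> pa; apply: sp; lia.
by apply: deg_le_widen (sq a); lia.
Qed.

Lemma isum_widen p q p' q' s : p <= p' -> q <= q' -> isummable p q s ->
  isum p' q' s = isum p q s.
Proof.
move=> pp' qq' spq.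
transitivity (isum p' q s).
  apply: lsum_widen; first by lia.
  exact: isummable_sum (isummable_widen pp' (lexx q) spq).
have [n ->] : exists n : nat, p' = p + n%:Z by exists (absz (p' - p)%R); lia.
elim: n => [|n IHn]; first by rewrite addr0.
rewrite -IHn /isum lsum_recl; last first.
  by apply: isummable_sum (isummable_widen _ (lexx q) spq); lia.
rewrite spq.1 ?add0r; last by lia.
rewrite (_ : p + n.+1 + q - 1 = p + n + q); last by lia.
by apply: eq_lsum => i; congr s; lia.
Qed.

Lemma isum_indep p q p' q' s : isummable p q s -> isummable p' q' s ->
  isum p q s = isum p' q' s.
Proof.
move=> s1 s2; rewrite -(isum_widen (p' := Num.max p p') (q' := Num.max q q') _ _ s1);
  rewrite ?le_max ?lexx //.
by apply: isum_widen; rewrite ?le_max ?lexx ?orbT.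
Qed.

Lemma isumD p q s t : isummable p q s -> isummable p q t ->
  isum p q s + isum p q t = isum p q (fun a => s a + t a).
Proof. by move=> ss st; apply: lsumD; apply: isummable_sum. Qed.

Lemma isum_mulr p q d s g : isummable p q s -> deg_le d g ->
  isum p q s * g = isum p (q + d) (fun a => s a * g).
Proof.
by move=> ss gd; rewrite /isum (lsum_mulr (isummable_sum ss) gd) addrA.
Qed.
Lemma isum_mull p q d s g : isummable p q s -> deg_le d g ->
  g * isum p q s = isum p (q + d) (fun a => g * s a).
Proof.
by move=> ss gd; rewrite /isum (lsum_mull (isummable_sum ss) gd) addrA.
Qed.

Lemma eq_isum p q s t : (forall a, s a = t a) -> isum p q s = isum p q t.
Proof. by move=> st; apply: eq_lsum => i. Qed.

(** The value f(z + al), obtained by substituting the powers of z + al for those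
    of z.  Any bound on the degree of f may be used (shiftE). *)
Definition shift al f : L :=
  isum (sval (cid (lcoef_bounded f))) 0 (fun a => lconst (f a) * zplusX al a).

Lemma shift_summable al p f : deg_le p f ->
  isummable p 0 (fun a => lconst (f a) * zplusX al a).
Proof.
move=> fp; split=> a; first by move=> /fp ->; rewrite rmorph0 mul0r.
by apply: degM_le (@deg_const _ _) (@deg_zplusX _ _) _; rewrite add0r addr0.
Qed.

Lemma shiftE al p f : deg_le p f ->
  shift al f = isum p 0 (fun a => lconst (f a) * zplusX al a).
Proof.
move=> fp; rewrite /shift; apply: isum_indep; apply: shift_summable => //.
exact: svalP (cid (lcoef_bounded f)).
Qed.

Lemma deg_shift al p f : deg_le p f -> deg_le p (shift al f).
Proof. by move=> fp; rewrite (shiftE al fp) /isum addr0; apply: deg_lsum. Qed.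

Lemma lead_shift al p f : deg_le p f -> shift al f p = f p.
Proof.
move=> fp; rewrite (shiftE al fp) /isum addr0 (@lsumE _ _ _ _ 1) ?subrr //.
  rewrite big_ord1 subr0 lconstM; case: (lmonic_zplusX al p) => _ ->.
  by rewrite mulr1.
move=> i.
by have /(_ i) := isummable_sum (shift_summable al fp); rewrite addr0.
Qed.

Lemma lmonic_shift al d f : lmonic d f -> lmonic d (shift al f).
Proof.
by case=> fd f1; split; [exact: deg_shift|rewrite lead_shift].
Qed.

Lemma shift_zmod al : zmod_morphism (shift al).
Proof.
have sD : {morph shift al : f g / f + g}.
  move=> f g; case: (ldeg2 f g) => p [fp gp].
  rewrite (shiftE al (degD fp gp)) (shiftE al fp) (shiftE al gp).
  rewrite isumD; [|exact: shift_summable..].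
  by apply: eq_isum => a; rewrite -mulrDl -rmorphD.
move=> f g; apply: (@addIr _ (shift al g)).
by rewrite -sD !subrK.
Qed.

Lemma shift_const al a : shift al (lconst a) = lconst a.
Proof.
rewrite (shiftE al (@deg_const _ a)) /isum addr0 lsum_recl; last first.
  move=> i.
  by have /(_ i) := isummable_sum (shift_summable al (@deg_const _ a)); rewrite addr0.
rewrite [lconst a _]lmonE subr0 eqxx mulr1; apply: laurentP => m.
rewrite lcoefD [X in _ + X](_ : _ = 0) ?addr0 //.
have -> : lsum (0 - 1) (fun i => lconst (lconst a (0 - i.+1%:Z)) * zplusX al (0 - i.+1%:Z)) =
  lsum (-1) (fun=> 0).
  rewrite sub0r; apply: eq_lsum => i; rewrite [lconst a _]lmonE.
  by rewrite (_ : (_ == _) = false) ?rmorph0 ?mul0r //; lia.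
by rewrite /= /lsum_fun; case: ifP => // _; rewrite big1.
Qed.

Lemma shift_scal al k : shift al (scal k) = scal k.
Proof. exact: shift_const. Qed.

(** The product of the two sums is regrouped by the total exponent, by additivity
    of the exponents of z + al. *)
Lemma shift_monoid al : monoid_morphism (shift al).
Proof.
split=> [|f g]; first by rewrite (shift_const al 1).
case: (lcoef_bounded f) (lcoef_bounded g) => p fp [q gq].
have fgpq := degM fp gq.
rewrite (shiftE al fp) (isum_mulr (shift_summable al fp) (deg_shift al gq)).
rewrite (shiftE al gq) (shiftE al fgpq) /isum !addr0 add0r.
pose u i j := lconst (f (p - i%:Z)) * zplusX al (p - i%:Z) *
  (lconst (g (q - j%:Z)) * zplusX al (q - j%:Z)).
transitivity (lsum (p + q) (fun i => lsum (p + q - i%:Z) (u i))); last first.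
  apply: eq_lsum => i; rewrite (_ : p + q - i%:Z = q + (p - i%:Z)); last by lia.
  rewrite -lsum_mull //.
    by have := isummable_sum (shift_summable al gq); rewrite addr0.
  by apply: degM_le (@deg_const _ _) (@deg_zplusX _ _) _; lia.
rewrite lsum_cauchy; last first.
  move=> i j; apply: (@degM_le _ (p - i%:Z) (q - j%:Z)); last by lia.
    by apply: degM_le (@deg_const _ _) (@deg_zplusX _ _) _; lia.
  by apply: degM_le (@deg_const _ _) (@deg_zplusX _ _) _; lia.
apply: eq_lsum => n; rewrite (lcoefMn n fp gq) rmorph_sum mulr_suml.
apply: eq_bigr => i _; rewrite /u rmorphM.
rewrite (_ : p + q - n%:Z = (p - i%:Z) + (q - (n - i)%N%:Z)); last first.
  by have := ltn_ord i; lia.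
by rewrite zplusXD !mulrA; congr (_ * _); rewrite -!mulrA zplusXC.
Qed.

HB.instance Definition _ al := GRing.isZmodMorphism.Build _ _ (shift al) (shift_zmod al).
HB.instance Definition _ al := GRing.isMonoidMorphism.Build _ _ (shift al) (shift_monoid al).

Lemma shift_var al : shift al (lmon 1 1) = zplus al.
Proof.
rewrite (shiftE al (@deg_mon _ 1 1)) /isum addr0 lsum_recl; last first.
  move=> i.
  by have /(_ i) := isummable_sum (shift_summable al (@deg_mon _ 1 1)); rewrite addr0.
rewrite subr0 lmonE eqxx rmorph1 mul1r subrr /= expr1.
apply: laurentP => m; rewrite lcoefD [X in _ + X](_ : _ = 0) ?addr0 //.
have -> : lsum 0 (fun i => lconst (if 1 - i.+1%:Z == 1 then 1 else 0) * zplusX al (1 - i.+1%:Z)) =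
  lsum 0 (fun=> 0).
  by apply: eq_lsum => i; rewrite (_ : (_ == _) = false) ?rmorph0 ?mul0r //; lia.
by rewrite /= /lsum_fun; case: ifP => // _; rewrite big1.
Qed.

End Shift.

(** * Series in two variables and their values *)

Section TwoVariables.
Variables (K : fieldType) (A : pzAlgType K).
Local Notation L := (laurent A).
Local Notation L2 := (laurent (laurent A)).
Implicit Types (f g : L) (s : L2) (t : L) (al be : K).

(** In L2 the outer variable is z and the inner one is w.  The product in L2
    then contains both f(z) g(w) and g(w) f(z), with noncommuting coefficients,
    and z and w are central. *)
Definition inz : {rmorphism L -> L2} := lmap (@lconst A).
Definition inw : {rmorphism L -> L2} := @lconst L.

Lemma inwM g s a : (inw g * s) a = g * s a.
Proof. exact: lconstM. Qed.

Lemma inzwE f g a b : (inz f * inw g) a b = f a * g b.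
Proof. by rewrite lMmon subr0 lmonM subr0. Qed.
Lemma inwzE f g a b : (inw g * inz f) a b = g b * f a.
Proof. by rewrite lmonM subr0 lMmon subr0. Qed.

Lemma inz_var : inz (lmon 1 1) = lmon 1 1.
Proof.
apply: laurentP => m; rewrite -[LHS]/(lconst ((lmon 1 1 : L) m)) !lmonE.
by case: (m == 1); rewrite ?rmorph1 ?rmorph0.
Qed.

Definition zw : L2 := inz (lmon 1 1) - inw (lmon 1 1).

Lemma zwM s a b : (zw * s) a b = @mulzw K A (fun a b => s a b) a b.
Proof.
rewrite /zw inz_var mulrBl /mulzw -(mul1r (s (a - 1))) -lmonM.
by rewrite -[s a (b - 1)]mul1r -lmonM -inwM.
Qed.

Lemma scalL2M k s a b : (scal k * s) a b = scal k * s a b.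
Proof. by rewrite -lconstM -(lconstM (scal k : L)). Qed.

Definition pzw (p : {poly K}) : L2 := \sum_(n < size p) scal p`_n * zw ^+ n.

Lemma pzwM p s a b : (pzw p * s) a b = @polyzw K A p (fun a b => s a b) a b.
Proof.
rewrite /pzw mulr_suml !lcoef_sum; apply: eq_bigr => n _.
have -> : iter n (@mulzw K A) (fun a b => s a b) = (fun a b => (zw ^+ n * s) a b).
  elim: (nat_of_ord n) => [|k IHk]; first by rewrite expr0 mul1r.
  rewrite iterS IHk; apply/funext => c; apply/funext => d.
  by rewrite exprS -mulrA zwM.
by rewrite -mulrA scalL2M.
Qed.

Lemma zwC s : zw * s = s * zw.
Proof.
rewrite /zw inz_var mulrBl mulrBr lvarC; congr (_ - _).
by apply: laurentP => m; rewrite lconstM lMconst lvarC.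
Qed.

Lemma pzwC p s : pzw p * s = s * pzw p.
Proof.
rewrite /pzw mulr_suml mulr_sumr; apply: eq_bigr => n _.
rewrite -mulrA [RHS]mulrA -[s * scal _]scalC -[RHS]mulrA; congr (_ * _).
  elim: (nat_of_ord n) => [|k IHk]; first by rewrite expr0 mulr1 mul1r.
  by rewrite exprSr -mulrA zwC !mulrA IHk.
Qed.

(** In L2 the degree in w of the coefficient of z^a may depend on a.  Substituting
    z = x + al makes sense only under a uniform bound. *)
Definition ubounded p q s := deg_le p s /\ forall a, deg_le q (s a).

Lemma ubounded_widen p q p' q' s : p <= p' -> q <= q' ->
  ubounded p q s -> ubounded p' q' s.
Proof.
move=> pp' qq' [sp sq]; split=> [|a]; first exact: deg_le_widen sp.
exact: deg_le_widen (sq a).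
Qed.

(** The value of s(z, w) at z = x + al, w = x + be is t.  This is a relation
    because not all series in z and w have a value. *)
Definition eval_at al be s t := exists p q,
  ubounded p q s /\ t = isum p q (fun a => shift be (s a) * zplusX A al a).

Lemma eval_at_summable al be p q s : ubounded p q s ->
  isummable p q (fun a => shift be (s a) * zplusX A al a).
Proof.
case=> sp sq; split=> [a pa|a]; first by rewrite sp // rmorph0 mul0r.
by apply: degM_le (deg_shift be (sq a)) (@deg_zplusX _ _ _ _) _; lia.
Qed.

Lemma eval_at_uniq al be s t t' : eval_at al be s t -> eval_at al be s t' -> t = t'.
Proof.
move=> [p [q [s1 ->]]] [p' [q' [s2 ->]]].
by apply: isum_indep; apply: eval_at_summable.
Qed.

Lemma eval_at0 al be : eval_at al be 0 0.
Proof.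
exists 0, 0; split=> //.
rewrite (@eq_isum _ _ _ _ _ (fun=> 0)) => [|a]; last by rewrite rmorph0 mul0r.
apply: laurentP => m; rewrite /isum /= /lsum_fun.
by case: ifP => // _; rewrite big1.
Qed.

Lemma eval_atD al be s t s' t' : eval_at al be s t -> eval_at al be s' t' ->
  eval_at al be (s + s') (t + t').
Proof.
move=> [p [q [s1 ->]]] [p' [q' [s2 ->]]].
exists (Num.max p p'), (Num.max q q').
have u1 := ubounded_widen (p' := Num.max p p') (q' := Num.max q q') _ _ s1.
have u2 := ubounded_widen (p' := Num.max p p') (q' := Num.max q q') _ _ s2.
rewrite ?le_max ?lexx ?orbT in u1, u2.
move: (u1 isT isT) (u2 isT isT) => {}u1 {}u2.
split.
  case: u1 u2 => [u1 v1] [u2 v2]; split=> [|a]; first exact: degD.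
  by apply: degD.
rewrite (isum_indep (eval_at_summable al be s1) (eval_at_summable al be u1)).
rewrite (isum_indep (eval_at_summable al be s2) (eval_at_summable al be u2)).
rewrite isumD; try exact: eval_at_summable.
by apply: eq_isum => a; rewrite -mulrDl -rmorphD.
Qed.

Lemma eval_at_sum al be I (r : seq I) (P : pred I) (s : I -> L2) (t : I -> L) :
  (forall i, P i -> eval_at al be (s i) (t i)) ->
  eval_at al be (\sum_(i <- r | P i) s i) (\sum_(i <- r | P i) t i).
Proof.
by move=> st; elim/big_rec2: _ => [|i y x Pi]; [exact: eval_at0|apply: eval_atD; apply: st].
Qed.

Lemma eval_at_inzw al be f g : eval_at al be (inz f * inw g) (shift al f * shift be g).
Proof.
case: (lcoef_bounded f) (lcoef_bounded g) => p fp [q gq].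
have zwE a : (inz f * inw g) a = lconst (f a) * g by exact: lMconst.
exists p, q; split.
  split=> [a pa|a]; rewrite zwE; first by rewrite fp // rmorph0 mul0r.
  by apply: degM_le (@deg_const _ _) gq _; rewrite add0r.
rewrite (shiftE al fp) (isum_mulr (shift_summable al fp) (deg_shift be gq)).
rewrite add0r; apply: eq_isum => a.
by rewrite zwE rmorphM /= shift_const -!mulrA zplusXC.
Qed.

Lemma eval_at_inwz al be f g : eval_at al be (inw g * inz f) (shift be g * shift al f).
Proof.
case: (lcoef_bounded f) (lcoef_bounded g) => p fp [q gq].
have wzE a : (inw g * inz f) a = g * lconst (f a) by exact: lconstM.
exists p, q; split.
  split=> [a pa|a]; rewrite wzE; first by rewrite fp // rmorph0 mulr0.
  by apply: degM_le gq (@deg_const _ _) _; rewrite addr0.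
rewrite (shiftE al fp) (isum_mull (shift_summable al fp) (deg_shift be gq)).
rewrite add0r; apply: eq_isum => a.
by rewrite wzE rmorphM /= shift_const -!mulrA.
Qed.

Lemma eval_at_scal al be k s t : eval_at al be s t -> eval_at al be (scal k * s) (scal k * t).
Proof.
move=> [p [q [s1 ->]]].
have kE a : (scal k * s : L2) a = scal k * s a by exact: lconstM.
have dk : deg_le 0 (scal k : L) by exact: deg_const.
exists p, q; split.
  case: s1 => sp sq; split=> [a pa|a]; rewrite kE; first by rewrite sp ?mulr0.
  by apply: degM_le dk (sq a) _; rewrite add0r.
rewrite (isum_mull (eval_at_summable al be s1) dk) addr0; apply: eq_isum => a.
by rewrite kE rmorphM /= shift_scal mulrA.
Qed.

(** Multiplying by z shifts the outer exponents, hence multiplies the value by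
    x + al; multiplying by w multiplies it by x + be. *)
Lemma eval_at_zw al be s t : eval_at al be s t ->
  eval_at al be (zw * s) (scal (al - be) * t).
Proof.
move=> [p [q [s1 ->]]].
have s2 := ubounded_widen (p' := p + 1) (q' := q + 1) _ _ s1.
have {}s2 : ubounded (p + 1) (q + 1) s by apply: s2; lia.
have bz : ubounded (p + 1) q (lmon 1 1 * s).
  case: s1 => sp sq; split=> [a pa|a]; rewrite lmonM mul1r //.
  by rewrite sp //; lia.
have bw : ubounded p (q + 1) (inw (lmon 1 1) * s).
  case: s1 => sp sq; split=> [a pa|a]; rewrite inwM.
    by rewrite sp // mulr0.
  by apply: degM_le (@deg_mon _ _ _) (sq a) _; rewrite addrC.
have sz : eval_at al be (lmon 1 1 * s)
    (zplus A al * isum p q (fun a => shift be (s a) * zplusX A al a)).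
  exists (p + 1), q; split=> //.
  have [d1 _] := lmonic_zplus A al.
  rewrite (isum_mull (eval_at_summable al be s1) d1) /isum.
  rewrite (_ : p + 1 + q = p + (q + 1)); last by lia.
  apply: eq_lsum => i; rewrite lmonM mul1r.
  rewrite (_ : p + 1 - i%:Z - 1 = p - i%:Z); last by lia.
  rewrite (_ : p + 1 - i%:Z = p - i%:Z + 1); last by lia.
  by rewrite zplusXS !mulrA zplusC.
have sw : eval_at al be (inw (lmon 1 1) * s)
    (zplus A be * isum p q (fun a => shift be (s a) * zplusX A al a)).
  exists p, (q + 1); split=> //.
  have [d1 _] := lmonic_zplus A be.
  rewrite (isum_mull (eval_at_summable al be s1) d1); apply: eq_isum => a.
  by rewrite inwM rmorphM /= shift_var mulrA.
have := eval_atD sz (eval_at_scal (-1) sw).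
rewrite !rmorphN1 !mulN1r -!mulrBl /zw inz_var.
by congr eval_at; congr (_ * _); rewrite opprD addrACA subrr add0r -rmorphB.
Qed.

(** This is how the RTT relation, cleared of its denominators, is evaluated at
    fixed values of z - w. *)
Lemma eval_at_pzw al be p s t : eval_at al be s t ->
  eval_at al be (pzw p * s) (scal p.[al - be] * t).
Proof.
move=> st; rewrite /pzw horner_coef rmorph_sum !mulr_suml.
apply: eval_at_sum => n _; rewrite rmorphM -!mulrA; apply: eval_at_scal.
elim: (nat_of_ord n) => [|k IHk]; first by rewrite !expr0 rmorph1 !mul1r.
by rewrite exprS -mulrA exprS rmorphM -mulrA; apply: eval_at_zw.
Qed.

End TwoVariables.

(** * Quantum minors *)

Section QuantumMinors.
Variables (B : pzRingType) (n : nat) (C : Type) (t : nat -> 'I_n.+1 -> C -> B).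
Hypothesis no2 : forall x : B, x + x = 0 -> x = 0.
Implicit Types (s : 'S_n.+1) (J : nat -> C) (k m a : nat).

Definition qprod k1 k2 J s := \prod_(k1 <= a < k2) t a (s (inord a)) (J a).

(** The quantum minor of size k on the first rows and the columns J, where t a
    stands for T(u + a).  Permutations of all rows supported on the first k are
    used, so that minors of different sizes are sums over subgroups of one
    group. *)
Definition qminor k J : B :=
  \sum_(s | perm_on [set a : 'I_n.+1 | (a < k)%N] s) (-1) ^+ s * qprod 0 k J s.

(** The expression t_{ij}(u + a) t_{kl}(u + a + 1), antisymmetrised in the rows i
    and k, is antisymmetric in the columns j and l. *)
Definition col_anti a (j l : C) := forall i k : 'I_n.+1,
  t a i j * t a.+1 k l - t a k j * t a.+1 i l
  + (t a i l * t a.+1 k j - t a k l * t a.+1 i j) = 0.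

Lemma qprod_cat k1 k2 k3 J s : (k1 <= k2)%N -> (k2 <= k3)%N ->
  qprod k1 k3 J s = qprod k1 k2 J s * qprod k2 k3 J s.
Proof. by move=> h1 h2; rewrite /qprod (big_cat_nat (n := k2)). Qed.

Lemma eq_qprod k1 k2 J J' s s' :
  (forall a, (k1 <= a < k2)%N -> s (inord a) = s' (inord a)) ->
  (forall a, (k1 <= a < k2)%N -> J a = J' a) -> qprod k1 k2 J s = qprod k1 k2 J' s'.
Proof.
move=> ss' JJ'; rewrite /qprod big_nat [RHS]big_nat.
by apply: eq_bigr => a ha; rewrite ss' // JJ'.
Qed.

Lemma qprodS k J s : qprod k k.+1 J s = t k (s (inord k)) (J k).
Proof. by rewrite /qprod big_nat1. Qed.

Lemma eq_qminor k J J' : (forall a, (a < k)%N -> J a = J' a) -> qminor k J = qminor k J'.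
Proof.
by move=> JJ'; apply: eq_bigr => s _; congr (_ * _); apply: eq_qprod => // a /JJ'.
Qed.

(** The permutation sum is paired with its translate by the transposition of m
    and m + 1, and the terms cancel four by four. *)
Lemma qminor_swap k J J' m : (m.+1 < k)%N -> (k <= n.+1)%N ->
  (forall a, a <> m -> a <> m.+1 -> J' a = J a) ->
  J' m = J m.+1 -> J' m.+1 = J m -> col_anti m (J m) (J m.+1) ->
  qminor k J = - qminor k J'.
Proof.
move=> mk kn J'J J'm J'm1 anm.
pose tau : 'S_n.+1 := tperm (inord m) (inord m.+1).
have m1n : (m.+1 < n.+1)%N by lia.
have mn : (m < n.+1)%N by lia.
have nem : inord m != inord m.+1 :> 'I_n.+1.
  by apply/eqP => /(congr1 val); rewrite /= !inordK //; lia.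
have tauk : perm_on [set a : 'I_n.+1 | (a < k)%N] tau.
  apply/fintype.subsetP => x; rewrite !inE /tau.
  by case: tpermP => [->|->|]; rewrite ?eqxx // inordK //; lia.
have taud a : (a < n.+1)%N -> a <> m -> a <> m.+1 -> tau (inord a) = inord a.
  move=> an am am1; rewrite tpermD //; apply/eqP => /(congr1 val);
    by rewrite /= !inordK //; lia.
apply/eqP; rewrite -addr_eq0; apply/eqP/no2.
have re J1 : qminor k J1 = \sum_(s | perm_on [set a : 'I_n.+1 | (a < k)%N] s)
    (-1) ^+ (tau * s)%g * qprod 0 k J1 (tau * s)%g.
  rewrite /qminor (reindex_inj (mulgI tau)) /=; apply: eq_bigl => s.
  apply/idP/idP => hs; last exact: perm_onM.
  by rewrite -[s]mul1g -(tperm2 (inord m) (inord m.+1)) -mulgA; apply: perm_onM.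
rewrite {2}(re J) {2}(re J') /qminor -!big_split big1 //= => s _.
have pE J1 s1 : qprod 0 k J1 s1 = qprod 0 m J1 s1 *
   (t m (s1 (inord m)) (J1 m) * t m.+1 (s1 (inord m.+1)) (J1 m.+1)) * qprod m.+2 k J1 s1.
  rewrite (@qprod_cat 0 m) ?(@qprod_cat m m.+1 k) ?(@qprod_cat m.+1 m.+2 k) ?qprodS ?mulrA //; lia.
have X0 J1 s1 : (J1 = J) + (J1 = J') -> (s1 = s) + (s1 = (tau * s)%g) ->
    qprod 0 m J1 s1 = qprod 0 m J s /\ qprod m.+2 k J1 s1 = qprod m.+2 k J s.
  move=> hJ hs; split; apply: eq_qprod => a ha.
  - by case: hs => ->; rewrite // permM taud //; lia.
  - by case: hJ => -> //; apply: J'J; lia.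
  - by case: hs => ->; rewrite // permM taud //; lia.
  - by case: hJ => -> //; apply: J'J; lia.
rewrite !pE.
have [-> ->] := X0 J' s (inr erefl) (inl erefl).
have [-> ->] := X0 J (tau * s)%g (inl erefl) (inr erefl).
have [-> ->] := X0 J' (tau * s)%g (inr erefl) (inr erefl).
rewrite !permM tpermL tpermR J'm J'm1 odd_permM odd_tperm nem signr_addb expr1.
set X := qprod 0 m J s; set Y := qprod _ _ _ _.
have := anm (s (inord m)) (s (inord m.+1)); set ab := _ + _ => ab0.
transitivity ((-1) ^+ s * (X * ab * Y)); last by rewrite ab0 mulr0 mul0r mulr0.
rewrite /ab !mulN1r !(mulrDr, mulrDl, mulNr, mulrN) ?opprK.
by rewrite addrACA.
Qed.

(** Cofactors of the expansions along the last and along the first column.  The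
    order of the noncommuting factors forces a left coefficient in the first case
    and a right coefficient in the second. *)
Definition qminor_last k J (i : 'I_n.+1) : B :=
  \sum_(s | perm_on [set a : 'I_n.+1 | (a < k.+1)%N] s && (s (inord k) == i))
    (-1) ^+ s * qprod 0 k J s.
Definition qminor_first k J (i : 'I_n.+1) : B :=
  \sum_(s | perm_on [set a : 'I_n.+1 | (a < k.+1)%N] s && (s (inord 0) == i))
    (-1) ^+ s * qprod 1 k.+1 J s.

Lemma qminor_expand_last k J : qminor k.+1 J = \sum_i qminor_last k J i * t k i (J k).
Proof.
rewrite /qminor (partition_big (fun s => s (inord k)) xpredT) //=.
apply: eq_bigr => i _; rewrite mulr_suml; apply: eq_bigr => s /andP[_ /eqP si].
by rewrite (@qprod_cat 0 k) // qprodS si mulrA.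
Qed.

Lemma qminor_expand_first k J : qminor k.+1 J = \sum_i t 0 i (J 0%N) * qminor_first k J i.
Proof.
rewrite /qminor (partition_big (fun s => s (inord 0)) xpredT) //=.
apply: eq_bigr => i _; rewrite mulr_sumr; apply: eq_bigr => s /andP[_ /eqP si].
rewrite (@qprod_cat 0 1) // qprodS si.
by rewrite [LHS]mulrA -commr_sign -mulrA.
Qed.

Lemma eq_qminor_last k J J' i : (forall a, (a < k)%N -> J a = J' a) ->
  qminor_last k J i = qminor_last k J' i.
Proof.
by move=> JJ'; apply: eq_bigr => s _; congr (_ * _); apply: eq_qprod => // a /JJ'.
Qed.

Lemma eq_qminor_first k J J' i : (forall a, (0 < a <= k)%N -> J a = J' a) ->
  qminor_first k J i = qminor_first k J' i.
Proof.
by move=> JJ'; apply: eq_bigr => s _; congr (_ * _); apply: eq_qprod => // a /JJ'.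
Qed.

Lemma perm_on_fix k s : (k < n.+1)%N ->
  perm_on [set a : 'I_n.+1 | (a < k.+1)%N] s && (s (inord k) == inord k) =
  perm_on [set a : 'I_n.+1 | (a < k)%N] s.
Proof.
move=> kn; apply/andP/idP => [[sk /eqP sf]|sk]; last first.
  split; last by rewrite (out_perm sk) // inE inordK // ltnn.
  by apply: fintype.subset_trans sk _; apply/fintype.subsetP => a; rewrite !inE => /ltnW.
apply/fintype.subsetP => a; rewrite inE => sa.
have := fintype.subsetP sk a; rewrite !inE => /(_ sa).
rewrite ltnS leq_eqVlt => /orP[/eqP ak|//].
have aE : a = inord k by apply: val_inj; rewrite /= inordK.
by rewrite aE inE sf eqxx in sa.
Qed.

(** The permutations that fix k and move only the first k + 1 rows are those that
    move only the first k rows. *)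
Lemma qminor_last_diag k J : (k < n.+1)%N -> qminor_last k J (inord k) = qminor k J.
Proof. by move=> kn; apply: eq_bigl => s; rewrite perm_on_fix. Qed.

Lemma qminor_last0 k J (i : 'I_n.+1) : (k < i)%N -> qminor_last k J i = 0.
Proof.
move=> ki; rewrite /qminor_last big1 // => s /andP[sk /eqP si].
have kn : (k < n.+1)%N by apply: ltn_trans ki _.
have : s (inord k) \in [set a : 'I_n.+1 | (a < k.+1)%N].
  by rewrite (perm_closed _ sk) inE inordK.
by rewrite si inE ltnS leqNgt ki.
Qed.

Lemma qminor0 J : qminor 0 J = 1.
Proof.
rewrite /qminor (big_pred1 1%g) => [|s].
  by rewrite odd_perm1 expr0 mul1r /qprod big_geq.
apply/idP/eqP => [s1|->]; last exact: perm_on1.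
by apply/permP => a; rewrite perm1 (out_perm s1) ?inE.
Qed.

Definition insert_col (c : nat -> C) (p : C) (m a : nat) : C :=
  if (a < m)%N then c a else if a == m then p else c a.-1.

Lemma qminor_ins_swap c p k m : (m < k)%N -> (k < n.+1)%N -> col_anti m p (c m) ->
  qminor k.+1 (insert_col c p m) = - qminor k.+1 (insert_col c p m.+1).
Proof.
move=> mk kn an; apply: (@qminor_swap _ _ _ m) => //.
- move=> a am am1; rewrite /insert_col ltnS leq_eqVlt.
  have [/eqP|am'] := eqVneq a m; first by lia.
  rewrite /=; case: ltnP => // ma; have [/eqP|//] := eqVneq a m.+1; lia.
- by rewrite /insert_col ltnSn ltnNge leqnSn /= gtn_eqF.
- by rewrite /insert_col ltnn eqxx ltnn eqxx.
- by rewrite /insert_col ltnn eqxx ltnNge leqnSn /= gtn_eqF.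
Qed.

Lemma qminor_ins_front c p k : (k < n.+1)%N ->
  (forall m, (m < k)%N -> col_anti m p (c m)) ->
  qminor k.+1 (insert_col c p 0) = (-1) ^+ k * qminor k.+1 (insert_col c p k).
Proof.
move=> kn an.
suff H m : (m <= k)%N -> qminor k.+1 (insert_col c p 0) = (-1) ^+ m * qminor k.+1 (insert_col c p m).
  exact: H.
elim: m => [|m IHm] mk; first by rewrite mul1r.
rewrite IHm ?(ltnW mk) // qminor_ins_swap //; last exact: an.
by rewrite exprSr mulrN1 mulrN mulNr.
Qed.

(** The column p moves to the left until it stands next to its copy; exchanging
    the two equal columns shows that the minor equals its opposite. *)
Lemma qminor_ins_repeat c p k q : (k < n.+1)%N -> (q < k)%N ->
  (forall m, (m < k)%N -> col_anti m p (c m)) -> p = c q ->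
  qminor k.+1 (insert_col c p k) = 0.
Proof.
move=> kn qk an pq.
have q0 : qminor k.+1 (insert_col c p q) = 0.
  apply: no2; rewrite {2}qminor_ins_swap //; last exact: an.
  rewrite (_ : qminor k.+1 (insert_col c p q.+1) = qminor k.+1 (insert_col c p q)) ?subrr //.
  apply: eq_qminor => a _; rewrite /insert_col ltnS leq_eqVlt.
  have [->|aq] := eqVneq a q; first by rewrite ltnn.
  rewrite /=; case: ltnP => // qa; have [->|//] := eqVneq a q.+1.
  by rewrite pq.
suff H d : (q + d <= k)%N -> qminor k.+1 (insert_col c p (q + d)) = 0.
  by have := H (k - q)%N; rewrite subnKC ?(ltnW qk) //; apply.
elim: d => [|d IHd] dk; first by rewrite addn0.
apply/eqP; rewrite addnS -oppr_eq0 -qminor_ins_swap ?IHd //; try lia.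
by apply: an; lia.
Qed.

End QuantumMinors.

(** * Two values of the RTT relation *)

Section RmatrixSums.
Variables (K : fieldType) (r : nat) (B : pzAlgType K).
Local Notation N := (2 * r)%N.
Implicit Types (x y : 'I_N * 'I_N) (c : K).

Lemma RpolyC x y : Rpoly K x y = Rpoly K y x.
Proof.
rewrite /Rpoly eq_sym; congr (_ + _ * _%:R - _ * _%:R).
  by rewrite /Pmx eq_sym andbC eq_sym.
by rewrite /Qmx andbC.
Qed.

Lemma Rpoly_horner x y c : (Rpoly K x y).[c] =
  c * (c + r.-1%:R) * (x == y)%:R + (c + r.-1%:R) * (Pmx x y)%:R - c * (Qmx x y)%:R.
Proof.
rewrite /Rpoly !hornerE.
have hn (b : bool) : (b%:R : {poly K}).[c] = b%:R by case: b; rewrite ?hornerE.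
by rewrite !hn.
Qed.

Lemma sum_Rpoly c x (F : 'I_N * 'I_N -> B) :
  \sum_v scal (Rpoly K x v).[c] * F v =
  scal (c * (c + r.-1%:R)) * F x + scal (c + r.-1%:R) * F (x.2, x.1)
   - scal c * (if x.2 == rev_ord x.1 then \sum_p F (p, rev_ord p) else 0).
Proof.
under eq_bigr => v _ do rewrite Rpoly_horner rmorphB rmorphD mulrBl mulrDl.
rewrite sumrB big_split /=; congr (_ + _ - _).
- rewrite (bigD1 x) //= eqxx mulr1 big1 ?addr0 // => v /negPf vx.
  by rewrite eq_sym vx mulr0 rmorph0 mul0r.
- rewrite (bigD1 (x.2, x.1)) //= /Pmx !eqxx mulr1 big1 ?addr0 // => -[v1 v2] /= vx.
  rewrite (_ : _ && _ = false) ?mulr0 ?rmorph0 ?mul0r //.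
  by apply: contraNF vx => /andP[/eqP -> /eqP ->].
- rewrite /Qmx; case: ifP => _; last first.
    by rewrite big1 ?mulr0 // => v _; rewrite mulr0 rmorph0 mul0r.
  transitivity (\sum_p \sum_q scal (c * (q == rev_ord p)%:R) * F (p, q)).
    by rewrite pair_bigA; apply: eq_bigr => -[].
  rewrite mulr_sumr; apply: eq_bigr => p _.
  rewrite (bigD1 (rev_ord p)) //= eqxx mulr1 big1 ?addr0 // => q /negPf ->.
  by rewrite mulr0 rmorph0 mul0r.
Qed.

Lemma sum_Rpoly_r c y (F : 'I_N * 'I_N -> B) :
  \sum_v scal (Rpoly K v y).[c] * F v =
  scal (c * (c + r.-1%:R)) * F y + scal (c + r.-1%:R) * F (y.2, y.1)
   - scal c * (if y.2 == rev_ord y.1 then \sum_p F (p, rev_ord p) else 0).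
Proof. by rewrite -sum_Rpoly; apply: eq_bigr => v _; rewrite RpolyC. Qed.

End RmatrixSums.

Section SpecialisedRtt.
Variables (K : numFieldType) (n : nat) (B : pzAlgType K).
Hypothesis n_gt1 : (1 < n)%N.
Local Notation r := n.+1.
Local Notation N := (2 * r)%N.
Implicit Types (t : nat -> 'I_N -> 'I_N -> B).

Lemma scal_eq0 (k : K) (x : B) : k != 0 -> scal k * x = 0 -> x = 0.
Proof.
move=> k0 /(congr1 ( *%R (scal k^-1))).
by rewrite mulrA -rmorphM mulVf // rmorph1 mul1r mulr0.
Qed.

Lemma no_2torsion (x : B) : x + x = 0 -> x = 0.
Proof.
move=> xx; apply: (@scal_eq0 2%:R); first by rewrite pnatr_eq0.
by rewrite rmorph_nat mulr_natl mulr2n.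
Qed.

(** The RTT relation for T(u), with the spectral parameters specialised to u + a
    and u + b. *)
Definition shifted_rtt t := forall (a b : nat) (x y : 'I_N * 'I_N),
  \sum_v scal (Rpoly K x v).[a%:R - b%:R] * (t a v.1 y.1 * t b v.2 y.2) =
  \sum_v scal (Rpoly K v y).[a%:R - b%:R] * (t b x.2 v.2 * t a x.1 v.1).

Lemma shifted_rttE t (a b : nat) (i k j l : 'I_N) (c := a%:R - b%:R) :
  shifted_rtt t ->
  scal (c * (c + n%:R)) * (t a i j * t b k l) + scal (c + n%:R) * (t a k j * t b i l)
  - scal c * (if k == rev_ord i then \sum_p t a p j * t b (rev_ord p) l else 0) =
  scal (c * (c + n%:R)) * (t b k l * t a i j) + scal (c + n%:R) * (t b k j * t a i l)
  - scal c * (if l == rev_ord j then \sum_p t b k (rev_ord p) * t a i p else 0).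
Proof.
move=> /(_ a b (i, k) (j, l)); rewrite -/c.
rewrite [X in X = _ -> _](sum_Rpoly c _ (fun v => t a v.1 j * t b v.2 l)).
by rewrite [X in _ = X -> _](sum_Rpoly_r c _ (fun v => t b k v.2 * t a i v.1)).
Qed.

(** At z - w = -1 the R-matrix is, up to a factor, 1 - P plus a multiple of Q.
    The terms in Q do not contribute for these rows and columns, and the right
    hand side of RTT is antisymmetric in j and l. *)
Lemma rtt_anti t a (i k j l : 'I_N) : shifted_rtt t ->
  k != rev_ord i -> l != rev_ord j ->
  t a i j * t a.+1 k l - t a k j * t a.+1 i l
  + (t a i l * t a.+1 k j - t a k l * t a.+1 i j) = 0.
Proof.
move=> rtt ki lj.
have jl : j != rev_ord l by apply: contraNneq lj => ->; rewrite rev_ordK.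
have c1 : a%:R - a.+1%:R = -1 :> K by rewrite -natr1 opprD addNKr.
have nz : (1 - n%:R : K) != 0.
  by rewrite subr_eq0 eq_sym (eqr_nat _ n 1); lia.
have e1 := shifted_rttE a a.+1 i k j l rtt.
have e2 := shifted_rttE a a.+1 i k l j rtt.
move: e1 e2; rewrite c1 (negPf ki) (negPf lj) (negPf jl) !mulr0 !subr0.
have -> : -1 + n%:R = - (1 - n%:R) :> K by rewrite opprB addrC.
set q := 1 - n%:R in nz *; rewrite mulrNN mul1r rmorphN !mulNr -!mulrBr.
move=> e1 e2; apply: (scal_eq0 nz).
rewrite mulrDr e1 e2 -mulrDr.
set u := t a.+1 k l * _; set v := t a.+1 k j * _.
by rewrite addrC subrKA subrr mulr0.
Qed.

(** At z - w = - kappa the polynomial R-matrix is kappa Q, where kappa = n.  The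
    left hand side of RTT vanishes in the rows (i, k) because k is not i'. *)
Lemma rtt_orthogonal t a (i k : 'I_N) : shifted_rtt t -> k != rev_ord i ->
  \sum_p t (a + n)%N k (rev_ord p) * t a i p = 0.
Proof.
move=> rtt ki; have nz : (n%:R : K) != 0 by rewrite pnatr_eq0; lia.
have := shifted_rttE a (a + n) i k i (rev_ord i) rtt.
have -> : a%:R - (a + n)%N%:R = - n%:R :> K by rewrite natrD opprD addNKr.
rewrite (negPf ki) eqxx addNr !mulr0 !rmorph0 !mul0r !addr0 !subr0 sub0r.
by rewrite rmorphN mulNr opprK => /esym /(scal_eq0 nz).
Qed.
End SpecialisedRtt.

(** * The corner of the Gauss decomposition vanishes *)

Definition unitriL (B : pzRingType) N (F : 'I_N -> 'I_N -> B) :=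
  (forall i, F i i = 1) /\ (forall i j : 'I_N, (i < j)%N -> F i j = 0).
Definition unitriU (B : pzRingType) N (E : 'I_N -> 'I_N -> B) :=
  (forall i, E i i = 1) /\ (forall i j : 'I_N, (j < i)%N -> E i j = 0).
Definition gauss (B : pzRingType) N (t F : 'I_N -> 'I_N -> B) (h : 'I_N -> B)
    (E : 'I_N -> 'I_N -> B) :=
  forall i j, t i j = \sum_q F i q * h q * E q j.
Definition invertible (B : pzRingType) (x : B) := exists y, x * y = 1 /\ y * x = 1.

Lemma invertible_mulI (B : pzRingType) (x y z : B) :
  invertible x -> x * y = x * z -> y = z.
Proof. by case=> x' [_ xx'] /(congr1 ( *%R x')); rewrite !mulrA xx' !mul1r. Qed.
Lemma invertible_Imul (B : pzRingType) (x y z : B) :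
  invertible x -> y * x = z * x -> y = z.
Proof. by case=> x' [xx' _] /(congr1 ( *%R^~ x')); rewrite -!mulrA xx' !mulr1. Qed.
Lemma invertible1 (B : pzRingType) : invertible (1 : B).
Proof. by exists 1; rewrite mulr1. Qed.
Lemma invertibleM (B : pzRingType) (x y : B) :
  invertible x -> invertible y -> invertible (x * y).
Proof.
move=> [x' [x1 x2]] [y' [y1 y2]]; exists (y' * x'); split.
  by rewrite mulrA -[x * y * y']mulrA y1 mulr1.
by rewrite mulrA -[y' * x' * x]mulrA x2 mulr1.
Qed.

Section Corner.
Variables (K : numFieldType) (n : nat) (B : pzAlgType K).
Hypothesis n_gt1 : (1 < n)%N.
Local Notation r := n.+1.
Local Notation N := (2 * r)%N.
Variables (t F : nat -> 'I_N -> 'I_N -> B) (h : nat -> 'I_N -> B)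
  (E : nat -> 'I_N -> 'I_N -> B).
Hypothesis rtt : shifted_rtt t.
Hypothesis tE : forall a, gauss (t a) (F a) (h a) (E a).
Hypothesis FL : forall a, unitriL (F a).
Hypothesis EU : forall a, unitriU (E a).
Hypothesis h_inv : forall a i, invertible (h a i).

Lemma leq_rN : (r <= N)%N. Proof. by rewrite mul2n -addnn leq_addr. Qed.
Definition rowN (i : 'I_r) : 'I_N := widen_ord leq_rN i.
Definition colN (a : nat) : 'I_N := insubd (rowN ord0) a.
Lemma val_colN a : (a < N)%N -> colN a = a :> nat.
Proof. by move=> aN; rewrite val_insubd aN. Qed.

Local Notation trow := (fun a i p => t a (rowN i) p).

Lemma anti_trow a (p q : 'I_N) : q != rev_ord p -> col_anti trow a p q.
Proof.
move=> pq i k; apply: rtt_anti => //.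
apply/eqP => /(congr1 val) /=; have := ltn_ord i; have := ltn_ord k; lia.
Qed.

Lemma colN_anti a p q : (p < r)%N -> (q < r)%N -> col_anti trow a (colN p) (colN q).
Proof.
move=> pr qr; apply: anti_trow; apply/eqP => /(congr1 val) /=.
rewrite !val_colN; lia.
Qed.

(** The row of cofactors times T = F H E vanishes in the columns before k because
    of repeated columns, hence so do the entries before k of the row of cofactors
    times F, as the h_q are invertible.  The entries after k vanish because F is
    lower triangular; the entry k is the minor of size k. *)
Lemma gauss_minor k p : (k < r)%N ->
  (forall m, (m < k)%N -> col_anti trow m p (colN m)) ->
  qminor trow k.+1 (insert_col colN p k) = qminor trow k colN * h k (colN k) * E k (colN k) p.
Proof.
move=> kr anp.
pose g (q : 'I_N) := \sum_i qminor_last trow k colN i * F k (rowN i) q.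
have Dg p' : qminor trow k.+1 (insert_col colN p' k) = \sum_q g q * h k q * E k q p'.
  rewrite qminor_expand_last {2}/insert_col ltnn eqxx.
  under eq_bigr => i _.
    rewrite (tE k (rowN i) p') (@eq_qminor_last _ _ _ _ _ _ colN); last first.
      by move=> a ak; rewrite /insert_col ak.
    rewrite mulr_sumr; over.
  rewrite exchange_big; apply: eq_bigr => q _.
  by rewrite /g !mulr_suml; apply: eq_bigr => i _; rewrite !mulrA.
have g0 (q : 'I_N) : (k < q)%N -> g q = 0.
  move=> kq; rewrite /g big1 // => i _.
  case: (ltnP k i) => ki; first by rewrite qminor_last0 // mul0r.
  by rewrite (FL k).2 ?mulr0 //=; lia.
have gq0 m : (m < k)%N -> g (colN m) = 0.
  elim/ltn_ind: m => m IHm mk.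
  have mN : (m < N)%N by lia.
  have D0 : qminor trow k.+1 (insert_col colN (colN m) k) = 0.
    apply: (@qminor_ins_repeat _ _ _ _ (@no_2torsion K B) _ _ _ m) => // m' m'k.
    by apply: colN_anti; lia.
  move: D0; rewrite Dg (bigD1 (colN m)) //= big1 ?addr0 => [|q qNm].
    rewrite (EU k).1 mulr1 => gh; apply: invertible_Imul (h_inv k (colN m)) _.
    by rewrite gh mul0r.
  have [qm1|mq] := ltnP q m.
    rewrite (_ : q = colN q) ?IHm ?mul0r //; first by lia.
    by apply: val_inj; rewrite /= val_colN.
  rewrite (EU k).2 ?mulr0 // val_colN // ltn_neqAle mq andbT.
  by apply: contraNneq qNm => mq'; apply/eqP/val_inj; rewrite /= val_colN.
rewrite Dg (bigD1 (colN k)) //= [X in _ + X]big1 ?addr0 => [|q qk].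
  congr (_ * _ * _); rewrite /g (bigD1 (inord k)) //= qminor_last_diag //.
  rewrite (_ : rowN (inord k) = colN k); last first.
    by apply: val_inj; rewrite /= val_colN ?inordK //; lia.
  rewrite (FL k).1 mulr1 big1 ?addr0 // => i ik.
  case: (ltnP k i) => ki; first by rewrite qminor_last0 // mul0r.
  rewrite (FL k).2 ?mulr0 //= val_colN; last by lia.
  rewrite ltn_neqAle ki andbT.
  by apply: contraNneq ik => ik; apply/eqP/val_inj; rewrite /= inordK.
have [qk1|kq] := ltnP q k.
  rewrite (_ : q = colN q) ?gq0 ?mul0r //.
  by apply: val_inj; rewrite /= val_colN.
rewrite g0 ?mul0r // ltn_neqAle kq andbT.
by apply: contraNneq qk => kq'; apply/eqP/val_inj; rewrite /= val_colN; lia.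
Qed.

Lemma qminor_prod k : (k <= r)%N ->
  qminor trow k colN = \prod_(0 <= a < k) h a (colN a).
Proof.
elim: k => [|k IHk] kr; first by rewrite qminor0 big_geq.
rewrite big_nat_recr //= -IHk ?(ltnW kr) //.
rewrite (@eq_qminor _ _ _ _ _ _ (insert_col colN (colN k) k)); last first.
  move=> a; rewrite ltnS leq_eqVlt /insert_col => /orP[/eqP->|->] //.
  by rewrite ltnn eqxx.
rewrite gauss_minor //; last by move=> m mk; apply: colN_anti => //; lia.
by rewrite (EU k).1 mulr1.
Qed.

Let i0 := colN n.
Let j0 := colN r.

(** Indices count from 0, so i0 and j0 are the positions r and r + 1.  By
    qminor_prod, P is the minor on the first r rows and columns; for series the
    hypothesis on P follows by comparing leading coefficients
    (lmonic_anticomm). *)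
Lemma corner_zero :
  (forall e : B, let P := \prod_(0 <= a < r) h a (colN a) in
     e * P + P * e = 0 -> e = 0) ->
  E n i0 j0 = 0.
Proof.
move=> reg; set P := \prod_(0 <= a < r) h a (colN a) in reg.
have rN : (r < N)%N by lia.
have vi0 : i0 = n :> nat by rewrite val_colN; lia.
have vj0 : j0 = r :> nat by rewrite val_colN.
have ij0 : rev_ord i0 = j0 by apply: val_inj; rewrite /= vi0 vj0; lia.
have anj m : (m < n)%N -> col_anti trow m j0 (colN m).
  move=> mn; apply: anti_trow; rewrite -ij0 rev_ordK.
  by apply/eqP => /(congr1 val); rewrite /= vi0 val_colN; lia.
have ani m : (m < n)%N -> col_anti trow m i0 (colN m).
  by move=> mn; apply: colN_anti; lia.
pose D q := qminor trow r (insert_col colN q n).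
have Di : D i0 = P.
  rewrite /D /P -qminor_prod //; apply: eq_qminor => a; rewrite ltnS leq_eqVlt /insert_col.
  by case/orP=> [/eqP->|->] //; rewrite ltnn eqxx.
have Dj : D j0 = P * E n i0 j0.
  by rewrite /D gauss_minor // /P big_nat_recr //= -qminor_prod.
have D0 (q : 'I_N) : (q < n)%N -> D q = 0.
  move=> qn; have qE : q = colN q by apply: val_inj; rewrite /= val_colN.
  rewrite /D; apply: (@qminor_ins_repeat _ _ _ _ (@no_2torsion K B) _ _ _ q) => //.
  by move=> m mn; rewrite qE; apply: colN_anti; lia.
have Dfront q : (forall m, (m < n)%N -> col_anti trow m q (colN m)) ->
    qminor trow r (insert_col colN q 0) = (-1) ^+ n * D q.
  by move=> anq; rewrite (qminor_ins_front (@no_2torsion K B)).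
have DL q : D q = \sum_k qminor_last trow n colN k * t n (rowN k) q.
  rewrite /D qminor_expand_last; apply: eq_bigr => k _.
  rewrite [in t _ _ _]/insert_col ltnn eqxx; congr (_ * _).
  by apply: eq_qminor_last => a an; rewrite /insert_col an.
have DF q : qminor trow r (insert_col colN q 0) =
    \sum_i t 0 (rowN i) q * qminor_first trow n (fun a => colN a.-1) i.
  rewrite qminor_expand_first; apply: eq_bigr => i _; congr (_ * _).
  by apply: eq_qminor_first => a /andP[a0 _]; rewrite /insert_col ltn0 gtn_eqF.
(* the relation rtt_orthogonal between two cofactor expansions *)
have sum0 : \sum_q D (rev_ord q) * qminor trow r (insert_col colN q 0) = 0.
  under eq_bigr => q _.
    rewrite DL DF mulr_suml; under eq_bigr => k _ do rewrite mulr_sumr; over.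
  rewrite exchange_big big1 //= => k _; rewrite exchange_big big1 //= => i _.
  under eq_bigr => q _ do rewrite mulrA -[_ * _ * t 0 _ _]mulrA.
  rewrite -mulr_suml -mulr_sumr (_ : \sum_i0 _ = 0) ?mulr0 ?mul0r //.
  apply: (rtt_orthogonal n_gt1 0 rtt).
  apply/eqP => /(congr1 val) /=; have := ltn_ord i; have := ltn_ord k; lia.
(* in all terms other than q = r and q = r + 1 one of the two minors has a
   repeated column *)
have {sum0} anticomm : D j0 * D i0 + D i0 * D j0 = 0.
  have nij : j0 != i0 by apply/eqP => /(congr1 val); rewrite /= vi0 vj0; lia.
  move: sum0; rewrite (bigD1 i0) //= (bigD1 j0) //= big1 ?addr0 => [|q /andP[qi qj]].
    rewrite ij0 -{2}ij0 rev_ordK !Dfront //.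
    rewrite !mulrA !commr_sign -!mulrA -mulrDr => /(congr1 ( *%R ((-1) ^+ n))).
    by rewrite mulr0 mulrA -expr2 sqrr_sign mul1r.
  have [qn|nq] := ltnP q n.
    have qE : q = colN q by apply: val_inj; rewrite /= val_colN.
    rewrite [qminor _ _ _]Dfront ?(D0 q) ?mulr0 // => m mn.
    by rewrite qE; apply: colN_anti; lia.
  rewrite D0 ?mul0r //=.
  move: qi qj; rewrite -!(inj_eq val_inj) /= vi0 vj0; lia.
rewrite Dj Di in anticomm.
have invP : invertible P.
  rewrite /P; elim/big_rec: _ => [|a x _]; first exact: invertible1.
  exact: invertibleM.
apply: reg; apply: (invertible_mulI invP).
by rewrite mulr0 mulrDr mulrA.
Qed.

End Corner.

Section ConverseAlgebra.
Variables (K : comPzRingType) (A : pzAlgType K).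
(** Scalars of the converse algebra, in which matrix transposition is compatible
    with products. *)
Definition cscal (k : K) : A^c := scal k : A.
Lemma cscal1 : cscal 1 = 1. Proof. exact: (rmorph1 (@scal K A)). Qed.
Lemma cscalD : {morph cscal : x y / x + y}. Proof. exact: (rmorphD (@scal K A)). Qed.
Lemma cscalM : {morph cscal : x y / x * y}.
Proof. by move=> x y; rewrite mulrC; apply: (rmorphM (@scal K A)). Qed.
Lemma cscalC k (x : A^c) : cscal k * x = x * cscal k.
Proof. exact: (esym (scalC k (x : A))). Qed.
HB.instance Definition _ := PzRing_isPzAlgebra.Build K A^c
  cscal1 cscalD cscalM cscalC.
End ConverseAlgebra.

(** * The RTT relation for Laurent series *)

Section LaurentRtt.
Variables (K : fieldType) (r : nat) (A : pzAlgType K).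
Local Notation N := (2 * r)%N.
Local Notation L := (laurent A).
Implicit Types (T F E : 'I_N -> 'I_N -> L) (h : 'I_N -> L).

(** The relation is multiplied by the central series (z - w) (z - w + kappa), so
    that it becomes an identity in the ring of series in z and w. *)
Definition lrtt T := forall x y : 'I_N * 'I_N,
  \sum_v pzw A (Rpoly K x v) * (inz A (T v.1 y.1) * inw A (T v.2 y.2)) =
  \sum_v pzw A (Rpoly K v y) * (inw A (T x.2 v.2) * inz A (T x.1 v.1)).

Lemma lrttP T : lrtt T <-> forall x y a b, rttL T x y a b = rttR T x y a b.
Proof.
have lE x y a b : rttL T x y a b = (\sum_v pzw A (Rpoly K x v) *
    (inz A (T v.1 y.1) * inw A (T v.2 y.2))) a b.
  rewrite !lcoef_sum; apply: eq_bigr => v _; rewrite pzwM.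
  by congr polyzw; apply/funext => c; apply/funext => d; rewrite inzwE.
have rE x y a b : rttR T x y a b = (\sum_v pzw A (Rpoly K v y) *
    (inw A (T x.2 v.2) * inz A (T x.1 v.1))) a b.
  rewrite !lcoef_sum; apply: eq_bigr => v _; rewrite pzwM.
  by congr polyzw; apply/funext => c; apply/funext => d; rewrite inwzE.
split=> H x y; first by move=> a b; rewrite lE rE H.
by apply: laurentP => a; apply: laurentP => b; rewrite -lE -rE H.
Qed.

(** The entries of T2 in one variable are moved past those of T1 in the other
    variable, and R is moved first past T1 and then past T2. *)
Lemma lrtt_mul T1 T2 : lrtt T1 -> lrtt T2 ->
  (forall i j k l a b, T1 i j a * T2 k l b = T2 k l b * T1 i j a) ->
  lrtt (fun i j => \sum_k T1 i k * T2 k j).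
Proof.
move=> rtt1 rtt2 c12 x y.
have czw i j k l : inz A (T1 i j) * inw A (T2 k l) = inw A (T2 k l) * inz A (T1 i j).
  by apply: laurentP => a; apply: laurentP => b; rewrite inzwE inwzE c12.
have cwz i j k l : inw A (T1 i j) * inz A (T2 k l) = inz A (T2 k l) * inw A (T1 i j).
  by apply: laurentP => a; apply: laurentP => b; rewrite inzwE inwzE c12.
pose P1 (v w : 'I_N * 'I_N) := inz A (T1 v.1 w.1) * inw A (T1 v.2 w.2).
pose P2 (v w : 'I_N * 'I_N) := inz A (T2 v.1 w.1) * inw A (T2 v.2 w.2).
pose Q1 (v w : 'I_N * 'I_N) := inw A (T1 v.2 w.2) * inz A (T1 v.1 w.1).
pose Q2 (v w : 'I_N * 'I_N) := inw A (T2 v.2 w.2) * inz A (T2 v.1 w.1).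
transitivity (\sum_w (\sum_v pzw A (Rpoly K x v) * P1 v w) * P2 w y).
  under [RHS]eq_bigr => w _ do rewrite mulr_suml.
  rewrite [RHS]exchange_big; apply: eq_bigr => v _ /=.
  under [RHS]eq_bigr => w _ do rewrite -mulrA.
  rewrite -mulr_sumr; congr (_ * _).
  rewrite !rmorph_sum mulr_suml.
  under eq_bigr => k _ do rewrite mulr_sumr.
  rewrite pair_big; apply: eq_bigr => -[k l] _ /=.
  rewrite !rmorphM /P1 /P2 /= -!mulrA; congr (_ * _).
  by rewrite !mulrA cwz.
under eq_bigr => w _ do rewrite /P1 rtt1 mulr_suml.
rewrite exchange_big /=.
under eq_bigr => v _.
  under eq_bigr => w _.
    rewrite -/(Q1 x v) pzwC -mulrA.
    over.
  rewrite -mulr_sumr /P2 rtt2 mulr_sumr; over.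
rewrite exchange_big; apply: eq_bigr => w _ /=.
under eq_bigr => v _ do rewrite mulrA -pzwC -mulrA.
rewrite -mulr_sumr; congr (_ * _).
rewrite !rmorph_sum mulr_suml.
under [RHS]eq_bigr => k _ do rewrite mulr_sumr.
rewrite exchange_big pair_big; apply: eq_bigr => -[k l] _ /=.
rewrite !rmorphM /Q1 /= -!mulrA; congr (_ * _).
by rewrite !mulrA czw.
Qed.

End LaurentRtt.

(** The degree bound can be lowered forever. *)
Lemma lead_descent (A : pzRingType) (f : laurent A) :
  (forall p, deg_le p f -> f p = 0) -> f = 0.
Proof.
move=> lead0; case: (lcoef_bounded f) => p fp.
have fpk k : deg_le (p - k%:Z) f.
  elim: k => [|k IHk]; first by rewrite subr0.
  move=> m pm; have [km|mk] := ltP (p - k%:Z) m; first exact: IHk.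
  by rewrite (_ : m = p - k%:Z) ?lead0 //; lia.
by apply: laurentP => m; apply: (fpk (absz (p - m)%R).+1); lia.
Qed.

Lemma lmonic_invertible (A : pzRingType) q (f : laurent A) : lmonic q f -> invertible f.
Proof. by case/lmonic_inv => g [_ fg gf]; exists g. Qed.

Section LaurentCorner.
Variables (K : numFieldType) (n : nat) (A : pzAlgType K).
Hypothesis n_gt1 : (1 < n)%N.
Local Notation r := n.+1.
Local Notation N := (2 * r)%N.
Local Notation L := (laurent A).
Variables (T F E : 'I_N -> 'I_N -> L) (h : 'I_N -> L) (d : 'I_N -> int).
Hypothesis rtt : lrtt T.
Hypothesis TE : gauss T F h E.
Hypothesis FL : unitriL F.
Hypothesis EU : unitriU E.
Hypothesis h_monic : forall i, lmonic (d i) (h i).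

Lemma lrtt_shifted : shifted_rtt (fun a i j => shift a%:R (T i j)).
Proof.
move=> a b x y; set c := a%:R - b%:R.
apply: (@eval_at_uniq _ _ a%:R b%:R (\sum_v pzw A (Rpoly K x v) *
    (inz A (T v.1 y.1) * inw A (T v.2 y.2)))).
  by apply: eval_at_sum => v _; apply: eval_at_pzw; apply: eval_at_inzw.
by rewrite rtt; apply: eval_at_sum => v _; apply: eval_at_pzw; apply: eval_at_inwz.
Qed.

Lemma shift_eq0 al (f : L) : shift al f = 0 -> f = 0.
Proof.
move=> sf; apply: lead_descent => p fp.
by rewrite -(lead_shift al fp) sf.
Qed.

(** The leading coefficient of e is its own opposite. *)
Lemma lmonic_anticomm q (P e : L) : lmonic q P -> e * P + P * e = 0 -> e = 0.
Proof.
move=> [Pq P1] eP; apply: lead_descent => p ep.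
apply: (@no_2torsion K); have /(congr1 (fun f : L => f (p + q))) := eP.
by rewrite lcoefD lead_mul // [p + q]addrC lead_mul // P1 mulr1 mul1r.
Qed.

Lemma shift_gauss a : gauss (fun i j => shift a (T i j)) (fun i j => shift a (F i j))
  (fun i => shift a (h i)) (fun i j => shift a (E i j)).
Proof.
by move=> i j; rewrite TE rmorph_sum; apply: eq_bigr => q _; rewrite !rmorphM.
Qed.

Let i0 := colN n n.
Let j0 := colN n r.

Lemma upper_corner : E i0 j0 = 0.
Proof.
apply: (@shift_eq0 n%:R).
pose sh (a : nat) := @shift K A a%:R.
apply: (@corner_zero K n (laurent A) n_gt1 (fun a i j => sh a (T i j))
  (fun a i j => sh a (F i j)) (fun a i => sh a (h i)) (fun a i j => sh a (E i j))).
- exact: lrtt_shifted.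
- by move=> a; apply: shift_gauss.
- move=> a; split=> [i|i j ij]; first by rewrite FL.1 /sh rmorph1.
  by rewrite FL.2 // /sh rmorph0.
- move=> a; split=> [i|i j ij]; first by rewrite EU.1 /sh rmorph1.
  by rewrite EU.2 // /sh rmorph0.
- by move=> a i; apply/lmonic_invertible/lmonic_shift/h_monic.
- move=> e P; suff [q Pq] : exists q, lmonic q P by apply: lmonic_anticomm Pq.
  rewrite /P; elim/big_rec: _ => [|a x _ [q xq]]; first by exists 0; exact: lmonic1.
  by exists (d (colN n a) + q); apply: lmonicM => //; apply/lmonic_shift/h_monic.
Qed.

(** Transposition turns T into a matrix over the converse algebra that satisfies
    the same relations, with the two unitriangular factors exchanged. *)
Lemma lower_corner : F j0 i0 = 0.
Proof.
apply: (@shift_eq0 n%:R).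
pose sh (a : nat) := @shift K A a%:R.
apply: (@corner_zero K n (laurent A)^c n_gt1 (fun a i j => sh a (T j i))
  (fun a i j => sh a (E j i)) (fun a i => sh a (h i)) (fun a i j => sh a (F j i))).
- move=> a b x y; have := lrtt_shifted a b y x.
  move=> /esym e; etransitivity; [|etransitivity; [exact: e|]].
    by apply: eq_bigr => v _; rewrite [LHS]scalC RpolyC.
  by apply: eq_bigr => v _; rewrite [RHS]scalC RpolyC.
- move=> a i j; rewrite [LHS](shift_gauss a%:R j i); apply: eq_bigr => q _.
  by rewrite -[LHS](mulrA (_ : laurent A)).
- move=> a; split=> [i|i j ij]; first by rewrite EU.1 /sh rmorph1.
  by rewrite EU.2 // /sh rmorph0.
- move=> a; split=> [i|i j ij]; first by rewrite FL.1 /sh rmorph1.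
  by rewrite FL.2 // /sh rmorph0.
- move=> a i; have [g [hg gh]] := lmonic_invertible (lmonic_shift a%:R (h_monic i)).
  by exists g.
- move=> e P.
  have [q Pq] : exists q, lmonic q (P : laurent A).
    rewrite /P; elim/big_rec: _ => [|a x _ [q xq]]; first by exists 0; exact: lmonic1.
    exists (q + d (colN n a)); apply: (lmonicM xq); apply/lmonic_shift/h_monic.
  by rewrite addrC; apply: lmonic_anticomm Pq.
Qed.

End LaurentCorner.

(** * Uniqueness and existence of Gauss decompositions *)

Section GaussUnique.
Variables (B : pzRingType) (N : nat).
Implicit Types (t F E : 'I_N -> 'I_N -> B) (h : 'I_N -> B).

(** By triangularity the sum for t i j ends with the term q = min(i, j), here
    called k. *)
Lemma gauss_trunc t F h E (i j k : 'I_N) : gauss t F h E -> unitriL F -> unitriU E ->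
  (k <= i)%N -> (k <= j)%N -> k = i \/ k = j ->
  t i j = \sum_(q < N | (q < k)%N) F i q * h q * E q j + F i k * h k * E k j.
Proof.
move=> tE [_ FL] [_ EU] ki kj kij; rewrite tE (bigD1 k) //= addrC; congr (_ + _).
rewrite [LHS](bigID (fun q : 'I_N => (q < k)%N)) /= [X in _ + X]big1 ?addr0.
  by apply: eq_bigl => q; rewrite andb_idl // => /ltn_eqF qk; rewrite -(inj_eq val_inj) /= qk.
move=> q /andP[qk]; rewrite -leqNgt leq_eqVlt (inj_eq val_inj) eq_sym (negPf qk) /= => kq.
by case: kij => e; [rewrite FL -?e // !mul0r|rewrite EU -?e // mulr0].
Qed.

(** Induction on k = min(i, j): the diagonal entry t k k determines h k, and then
    the k-th column and row of t determine those of F and E. *)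
Lemma gauss_unique t F h E F' h' E' : (forall i, invertible (h i)) ->
  gauss t F h E -> unitriL F -> unitriU E ->
  gauss t F' h' E' -> unitriL F' -> unitriU E' ->
  [/\ forall i j, F i j = F' i j, forall i, h i = h' i & forall i j, E i j = E' i j].
Proof.
move=> hI tE FL EU tE' FL' EU'.
have H (m : nat) (k : 'I_N) : (k < m)%N ->
    [/\ forall i, F i k = F' i k, h k = h' k & forall j, E k j = E' k j].
  elim: m k => // m IHm k; rewrite ltnS => km.
  have eqS i j : \sum_(q < N | (q < k)%N) F i q * h q * E q j =
                 \sum_(q < N | (q < k)%N) F' i q * h' q * E' q j.
    by apply: eq_bigr => q qk; have [-> -> ->] := IHm q (leq_trans qk km).
  have hk : h k = h' k.
    have := gauss_trunc tE FL EU (leqnn k) (leqnn k) (or_introl erefl).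
    rewrite (gauss_trunc tE' FL' EU' (leqnn k) (leqnn k) (or_introl erefl)) eqS.
    by rewrite FL.1 FL'.1 EU.1 EU'.1 !mul1r !mulr1 => /addrI.
  split=> // [i|j].
    have [ik|ki] := ltnP i k; first by rewrite FL.2 // FL'.2.
    have := gauss_trunc tE FL EU ki (leqnn k) (or_intror erefl).
    rewrite (gauss_trunc tE' FL' EU' ki (leqnn k) (or_intror erefl)) eqS.
    rewrite EU.1 EU'.1 !mulr1 -hk => /addrI Fh.
    by apply: invertible_Imul (hI k) _; rewrite Fh.
  have [jk|kj] := ltnP j k; first by rewrite EU.2 // EU'.2.
  have := gauss_trunc tE FL EU (leqnn k) kj (or_introl erefl).
  rewrite (gauss_trunc tE' FL' EU' (leqnn k) kj (or_introl erefl)) eqS.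
  rewrite FL.1 FL'.1 !mul1r -hk => /addrI hE.
  by apply: invertible_mulI (hI k) _; rewrite hE.
split=> [i j|i|i j]; last 1 first.
- by have [] := H _ i (ltnSn i).
- by have [] := H _ j (ltnSn j).
- by have [] := H _ i (ltnSn i).
Qed.

End GaussUnique.

Section GaussExists.
Variable A : pzRingType.
Local Notation L := (laurent A).

(** Matrices of the form 1 + O(z^-1). *)
Definition near1 N (M : 'I_N -> 'I_N -> L) :=
  (forall i, lmonic 0 (M i i)) /\ (forall i j, i != j -> deg_le (-1) (M i j)).

Lemma lmonic0D (f g : L) : lmonic 0 f -> deg_le (-1) g -> lmonic 0 (f + g).
Proof.
move=> [f0 f1] g1; split; last by rewrite lcoefD f1 g1 ?addr0.
by apply: degD => //; apply: deg_le_widen g1.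
Qed.

(** Gaussian elimination of the first row and column: the pivot is monic of
    degree 0, hence invertible, and the Schur complement M' is again
    1 + O(z^-1). *)
Lemma gauss_near1 N (M : 'I_N -> 'I_N -> L) : near1 M ->
  exists F h E, [/\ gauss M F h E, unitriL F, unitriU E,
    near1 F & near1 E /\ forall i, lmonic 0 (h i)].
Proof.
elim: N M => [|N IHN] M [M1 M0].
  exists M, (fun=> 0), M.
  by split; [case|split; case|split; case|split; case|split; [split; case|case]].
have [a' [a'1 aa' a'a]] := lmonic_inv (M1 ord0).
pose up := lift (@ord0 N).
pose M' (i j : 'I_N) := M (up i) (up j) - M (up i) ord0 * a' * M ord0 (up j).
rewrite oppr0 in a'1.
have neL i : up i != ord0 by rewrite eq_sym neq_lift.
have neR i : ord0 != up i by rewrite neq_lift.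
have dMa i : deg_le (-1) (M (up i) ord0 * a').
  by apply: degM_le (M0 _ _ (neL i)) a'1.1 _.
have daM i : deg_le (-1) (a' * M ord0 (up i)).
  by apply: degM_le a'1.1 (M0 _ _ (neR i)) _.
have dMaM i j : deg_le (-1) (- (M (up i) ord0 * a' * M ord0 (up j))).
  by apply: degN; apply: degM_le (dMa i) (M0 _ _ (neR j)) _.
have [|F' [h' [E' [gE [F1 F0] [E1 E0] [nF1 nF0] [[nE1 nE0] h1]]]]] := IHN M'.
  split=> [i|i j ij]; first exact: lmonic0D.
  by apply: degD => //; apply: M0; rewrite (inj_eq (@lift_inj _ _)).
pose F (i j : 'I_N.+1) := match unlift ord0 i, unlift ord0 j with
  | None, None => 1 | None, Some _ => 0
  | Some i', None => M i ord0 * a' | Some i', Some j' => F' i' j' end.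
pose E (i j : 'I_N.+1) := match unlift ord0 i, unlift ord0 j with
  | None, None => 1 | Some _, None => 0
  | None, Some j' => a' * M ord0 j | Some i', Some j' => E' i' j' end.
pose h (i : 'I_N.+1) := if unlift ord0 i is Some i' then h' i' else M ord0 ord0.
have un0 : unlift (@ord0 N) ord0 = None by rewrite unlift_none.
have unS i : unlift (@ord0 N) (up i) = Some i by rewrite liftK.
exists F, h, E; split.
- move=> i j; rewrite big_ord_recl.
  rewrite (eq_bigr (fun q => F i (up q) * h (up q) * E (up q) j)) //.
  rewrite /F /h /E un0.
  under eq_bigr => q _ do rewrite unS.
  case: (unliftP ord0 i) => [i' ->|->]; case: (unliftP ord0 j) => [j' ->|->].
  + rewrite -/(up i') -/(up j') -gE /M' -!mulrA [M ord0 ord0 * _]mulrA aa' mul1r.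
    by rewrite addrC subrK.
  + by rewrite big1 ?addr0 => [|q _]; rewrite ?mulr0 // mulr1 -mulrA a'a mulr1.
  + by rewrite big1 ?addr0 => [|q _]; rewrite ?mul0r // mul1r mulrA aa' mul1r.
  + by rewrite big1 ?addr0 => [|q _]; rewrite ?mul0r // mul1r mulr1.
- split=> [i|i j]; rewrite /F.
    by case: (unliftP ord0 i).
  case: (unliftP ord0 i) => [i' ->|->]; case: (unliftP ord0 j) => [j' ->|->] //.
  by move=> ij; apply: F0.
- split=> [i|i j]; rewrite /E.
    by case: (unliftP ord0 i).
  case: (unliftP ord0 i) => [i' ->|->]; case: (unliftP ord0 j) => [j' ->|->] //.
  by move=> ij; apply: E0.
- split=> [i|i j]; rewrite /F.
    by case: (unliftP ord0 i) => // _; apply: lmonic1.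
  case: (unliftP ord0 i) => [i' ->|->]; case: (unliftP ord0 j) => [j' ->|->] //.
  by rewrite (inj_eq (@lift_inj _ _)); apply: nF0.
- split; last by move=> i; rewrite /h; case: unlift.
  split=> [i|i j]; rewrite /E.
    by case: (unliftP ord0 i) => // _; apply: lmonic1.
  case: (unliftP ord0 i) => [i' ->|->]; case: (unliftP ord0 j) => [j' ->|->] //.
  by rewrite (inj_eq (@lift_inj _ _)); apply: nE0.
Qed.

End GaussExists.

(** * Gauss decomposition of a product *)

Section FunctionMatrices.
Variables (B : pzRingType) (N : nat).
Implicit Types (t F E : 'I_N -> 'I_N -> B) (h : 'I_N -> B).

Definition fmx t : 'M[B]_N := \matrix_(i, j) t i j.
Definition dmx h : 'M[B]_N := diag_mx (\row_i h i).

Lemma gaussP t F h E : gauss t F h E <-> fmx t = fmx F *m dmx h *m fmx E.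
Proof.
have mE i j : (fmx F *m dmx h *m fmx E) i j = \sum_q F i q * h q * E q j.
  by rewrite mxE; apply: eq_bigr => q _; rewrite mul_mx_diag !mxE.
split=> [tE|/matrixP tE i j]; last by rewrite -mE -tE mxE.
by apply/matrixP => i j; rewrite mE -tE mxE.
Qed.

Lemma fmx_mul t t' : fmx (fun i j => \sum_k t i k * t' k j) = fmx t *m fmx t'.
Proof. by apply/matrixP => i j; rewrite !mxE; apply: eq_bigr => k _; rewrite !mxE. Qed.

Lemma dmx_mul h h' : dmx h *m dmx h' = dmx (fun i => h i * h' i).
Proof.
apply/matrixP => i j; rewrite mul_mx_diag !mxE.
by case: (eqVneq i j) => [->|]; rewrite ?mulr1n ?mulr0n ?mul0r.
Qed.

Lemma dmx_conj h h' t :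
  fmx (fun i j => h i * t i j * h' j) = dmx h *m fmx t *m dmx h'.
Proof. by apply/matrixP => i j; rewrite mul_mx_diag mul_diag_mx !mxE. Qed.

Lemma unitriL_mul F F' : unitriL F -> unitriL F' ->
  unitriL (fun i j => \sum_k F i k * F' k j).
Proof.
move=> [F1 F0] [F1' F0']; split=> [i|i j ij].
  rewrite (bigD1 i) //= big1 => [|k ki]; first by rewrite F1 F1' mulr1 addr0.
  have [ik|ki'] := ltnP i k; first by rewrite F0 ?mul0r.
  by rewrite F0' ?mulr0 // ltn_neqAle ki' (inj_eq val_inj) ki.
rewrite big1 // => k _; have [ik|ki] := ltnP i k; first by rewrite F0 ?mul0r.
by rewrite F0' ?mulr0 //; apply: leq_ltn_trans ij.
Qed.

Lemma unitriU_mul E E' : unitriU E -> unitriU E' ->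
  unitriU (fun i j => \sum_k E i k * E' k j).
Proof.
move=> [E1 E0] [E1' E0']; split=> [i|i j ij].
  rewrite (bigD1 i) //= big1 => [|k ki]; first by rewrite E1 E1' mulr1 addr0.
  have [ik|ki'] := ltnP k i; first by rewrite E0 ?mul0r.
  by rewrite E0' ?mulr0 // ltn_neqAle ki' eq_sym (inj_eq val_inj) ki.
rewrite big1 // => k _; have [ik|ki] := ltnP k i; first by rewrite E0 ?mul0r.
by rewrite E0' ?mulr0 //; apply: leq_trans ij ki.
Qed.

End FunctionMatrices.

Section Near1.
Variables (A : pzRingType) (N : nat).
Implicit Types (M F E : 'I_N -> 'I_N -> laurent A).

Lemma near1P M : near1 M <-> forall i j, deg_le (-1) (M i j - (i == j)%:R).
Proof.
split=> [[M1 M0] i j|H].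
  have [<-|ij] := eqVneq i j; last by rewrite subr0; apply: M0.
  move=> m m1; have [->|m0] := eqVneq m 0.
    by rewrite lcoefD lcoefN lone (M1 i).2 subrr.
  rewrite lcoefD lcoefN lone (negPf m0) subr0 (M1 i).1 //; lia.
split=> [i|i j ij]; last by have := H i j; rewrite (negPf ij) subr0.
have Hi := H i i; rewrite eqxx in Hi.
by rewrite -(subrK 1 (M i i)) addrC; apply: lmonic0D Hi; exact: lmonic1.
Qed.

(** Writing the factors as 1 + e and 1 + e', the product is 1 + e e' + e + e'. *)
Lemma near1_mul M M' : near1 M -> near1 M' ->
  near1 (fun i j => \sum_k M i k * M' k j).
Proof.
move=> /near1P HM /near1P HM'; apply/near1P => i j.
pose e i j := M i j - (i == j)%:R; pose e' i j := M' i j - (i == j)%:R.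
have -> : \sum_k M i k * M' k j - (i == j)%:R =
    \sum_k e i k * e' k j + e i j + e' i j.
  have ee : \sum_k M i k * M' k j =
     \sum_k (e i k * e' k j + e i k * (k == j)%:R + (i == k)%:R * e' k j +
       (i == k)%:R * (k == j)%:R).
    apply: eq_bigr => k _.
    by rewrite -addrA -mulrDr -mulrDr -mulrDl !subrK.
  rewrite ee !big_split /=.
  have sr (f : 'I_N -> laurent A) : \sum_k f k * (k == j)%:R = f j.
    by rewrite (bigD1 j) //= eqxx mulr1 big1 ?addr0 // => k /negPf ->; rewrite mulr0.
  have sl (f : 'I_N -> laurent A) : \sum_k (i == k)%:R * f k = f i.
    rewrite (bigD1 i) //= eqxx mul1r big1 ?addr0 // => k /negPf.
    by rewrite eq_sym => ->; rewrite mul0r.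
  by rewrite (sr (e i)) (sl (fun k => e' k j)) (sr (fun k => (i == k)%:R)) addrK.
apply: degD; last exact: HM'.
apply: degD; last exact: HM.
by apply: deg_sum => k _; apply: degM_le (HM _ _) (HM' _ _) _.
Qed.

End Near1.

Section GaussMul.
Variables (K : numFieldType) (n : nat) (A : pzAlgType K).
Hypothesis n_gt1 : (1 < n)%N.
Local Notation r := n.+1.
Local Notation N := (2 * r)%N.
Local Notation L := (laurent A).

(** The shape of the Gauss decomposition in a shifted algebra, d being the
    leading exponents of the diagonal factor. *)
Record shifted_gauss (d : 'I_N -> int) (T F : 'I_N -> 'I_N -> L) (h : 'I_N -> L)
    (E : 'I_N -> 'I_N -> L) : Prop := ShiftedGauss {
  sg_gauss : gauss T F h E;
  sg_L : unitriL F;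
  sg_U : unitriU E;
  sg_nearL : near1 F;
  sg_nearU : near1 E;
  sg_monic : forall i, lmonic (d i) (h i) }.

Local Notation i0 := (colN n n).
Local Notation j0 := (colN n r).

(** The exponents in the positions r and r + 1, which are not compared by
    dominance, are left out. *)
Definition nonincreasing (d : 'I_N -> int) := forall i j : 'I_N, (i < j)%N ->
  (i, j) != (i0, j0) -> d j <= d i.

Lemma near1_unitri (M : 'I_N -> 'I_N -> L) : (forall i, M i i = 1) ->
  (forall i j, i != j -> deg_le (-1) (M i j)) -> near1 M.
Proof. by move=> M1 M0; split=> // i; rewrite M1; exact: lmonic1. Qed.

(** The factors are F = F1 F'' and E = E'' E2, where F'' and E'' are the conjugates of
    the factors F' and E' of E1 F2 by the diagonal matrices H1 and H2. *)
Lemma shifted_gauss_mul d1 d2 T1 T2 F1 h1 E1 F2 h2 E2 :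
  lrtt T1 -> lrtt T2 -> shifted_gauss d1 T1 F1 h1 E1 -> shifted_gauss d2 T2 F2 h2 E2 ->
  nonincreasing d1 -> nonincreasing d2 ->
  (forall i j k l a b, T1 i j a * T2 k l b = T2 k l b * T1 i j a) ->
  exists F h E, shifted_gauss (fun i => d1 i + d2 i)
    (fun i j => \sum_k T1 i k * T2 k j) F h E.
Proof.
move=> rtt1 rtt2 [T1E F1L E1U F1n E1n h1m] [T2E F2L E2U F2n E2n h2m] d1n d2n c12.
have rttT := lrtt_mul rtt1 rtt2 c12.
have [F' [h' [E' [ME F'L E'U F'n [E'n h'1]]]]] := gauss_near1 (near1_mul E1n F2n).
pose g1 i := sval (cid (lmonic_inv (h1m i))).
have g1P i : [/\ lmonic (- d1 i) (g1 i), h1 i * g1 i = 1 & g1 i * h1 i = 1].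
  exact: svalP (cid (lmonic_inv (h1m i))).
pose g2 i := sval (cid (lmonic_inv (h2m i))).
have g2P i : [/\ lmonic (- d2 i) (g2 i), h2 i * g2 i = 1 & g2 i * h2 i = 1].
  exact: svalP (cid (lmonic_inv (h2m i))).
pose F'' i j := h1 i * F' i j * g1 j.
pose E'' i j := g2 i * E' i j * h2 j.
pose h i := h1 i * h' i * h2 i.
pose F i j := \sum_k F1 i k * F'' k j.
pose E i j := \sum_k E'' i k * E2 k j.
have F''L : unitriL F''.
  split=> [i|i j ij]; rewrite /F''; last by rewrite F'L.2 // mulr0 mul0r.
  by rewrite F'L.1 mulr1; case: (g1P i).
have E''U : unitriU E''.
  split=> [i|i j ij]; rewrite /E''; last by rewrite E'U.2 // mulr0 mul0r.
  by rewrite E'U.1 mulr1; case: (g2P i).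
have TE : gauss (fun i j => \sum_k T1 i k * T2 k j) F h E.
  apply/gaussP; rewrite fmx_mul /F /E !fmx_mul.
  move/gaussP: T1E => ->; move/gaussP: T2E => ->; move/gaussP: ME.
  rewrite fmx_mul /F'' /E'' !dmx_conj => ME.
  rewrite -!mulmxA [fmx E1 *m (_ *m _)]mulmxA ME -!mulmxA.
  have inv1 : dmx g1 *m dmx h = dmx h' *m dmx h2.
    rewrite !dmx_mul; congr dmx; apply/funext => i; rewrite /h !mulrA.
    by have [_ _ ->] := g1P i; rewrite mul1r.
  have inv2 : dmx h2 *m dmx g2 = 1%:M.
    rewrite dmx_mul -diag_const_mx; congr diag_mx; apply/rowP => i; rewrite !mxE.
    by have [_ ->] := g2P i.
  rewrite [dmx g1 *m (dmx h *m _)]mulmxA inv1 -!mulmxA.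
  by rewrite [dmx h2 *m (dmx g2 *m _)]mulmxA inv2 mul1mx.
have FL : unitriL F := unitriL_mul F1L F''L.
have EU : unitriU E := unitriU_mul E''U E2U.
have hm i : lmonic (d1 i + d2 i) (h i).
  by have := lmonicM (lmonicM (h1m i) (h'1 i)) (h2m i); rewrite addr0.
(* the corner entries of the product vanish for all degrees, which bounds the
   corner entries of F'' and E'' by those of F1 and E2 *)
have cu : E i0 j0 = 0 := upper_corner n_gt1 rttT TE FL EU hm.
have cl : F j0 i0 = 0 := lower_corner n_gt1 rttT TE FL EU hm.
have vi0 : i0 = n :> nat by rewrite val_colN; lia.
have vj0 : j0 = r :> nat by rewrite val_colN; lia.
have ij0 : i0 != j0 by apply/eqP => /(congr1 val); rewrite /= vi0 vj0; lia.
have F''n : near1 F''.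
  apply: near1_unitri => [|i j ij]; first exact: F''L.1.
  have [lij|ji] := ltnP i j; first by rewrite F''L.2.
  have {ji}ltji : (j < i)%N by rewrite ltn_neqAle ji (inj_eq val_inj) eq_sym ij.
  have [[-> ->]|nji] := eqVneq (j, i) (i0, j0).
    move: cl; rewrite /F (bigD1 i0) //= (bigD1 j0) /=; last by rewrite eq_sym.
    rewrite F''L.1 F1L.1 mulr1 mul1r big1 ?addr0 => [|k /andP[ki kj]].
      move/eqP; rewrite addrC addr_eq0 => /eqP F''E.
      rewrite -[X in deg_le _ X]/(lcoef (F'' j0 i0)) F''E.
      by apply: degN; apply: F1n.2; rewrite eq_sym.
    have [ki'|ik] := ltnP k i0; first by rewrite F''L.2 ?mulr0.
    rewrite F1L.2 ?mul0r //.
    by move: ki kj ik; rewrite -!(inj_eq val_inj) /= vi0 vj0; lia.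
  have [[dg _] _ _] := g1P j.
  apply: degM_le (degM (h1m i).1 (F'n.2 i j ij)) dg _.
  by have := d1n j i ltji nji; lia.
have E''n : near1 E''.
  apply: near1_unitri => [|i j ij]; first exact: E''U.1.
  have [lji|ij'] := ltnP j i; first by rewrite E''U.2.
  have {ij'}ltij : (i < j)%N by rewrite ltn_neqAle ij' (inj_eq val_inj) ij.
  have [[-> ->]|nij] := eqVneq (i, j) (i0, j0).
    move: cu; rewrite /E (bigD1 i0) //= (bigD1 j0) /=; last by rewrite eq_sym.
    rewrite E''U.1 E2U.1 mulr1 mul1r big1 ?addr0 => [|k /andP[ki kj]].
      move/eqP; rewrite addrC addr_eq0 => /eqP E''E.
      rewrite -[X in deg_le _ X]/(lcoef (E'' i0 j0)) E''E.
      by apply: degN; apply: E2n.2.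
    have [ki'|ik] := ltnP k i0; first by rewrite E''U.2 ?mul0r.
    rewrite E2U.2 ?mulr0 //.
    by move: ki kj ik; rewrite -!(inj_eq val_inj) /= vi0 vj0; lia.
  have [[dg _] _ _] := g2P i.
  apply: degM_le (degM dg (E'n.2 i j ij)) (h2m j).1 _.
  by have := d2n i j ltij nij; lia.
exists F, h, E; split=> //; exact: near1_mul.
Qed.

End GaussMul.

(** * Algebras given by generators and relations *)

Section FreeAlgebraUniversal.
Variables (K : comNzRingType) (G : choiceType) (B : pzAlgType K) (g : G -> B).
Implicit Types x y : freeAlg K G.

Definition monEval (m : fmonom G) : B := \prod_(i <- (m : seq G)) g i.

Lemma monEvalM (m1 m2 : fmonom G) : monEval (mmul m1 m2) = monEval m1 * monEval m2.
Proof. by rewrite /monEval fmM big_cat. Qed.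

Definition freeEval x : B := \sum_(m <- msupp x) scal x@_m * monEval m.

Lemma freeEvalEw (d : {fset fmonom G}) x : (msupp x `<=` d)%fset ->
  freeEval x = \sum_(m <- d) scal x@_m * monEval m.
Proof.
move=> le; rewrite /freeEval (big_fset_incl _ le) // => m _ /mcoeff_outdom ->.
by rewrite rmorph0 mul0r.
Qed.

Lemma freeEvalD : {morph freeEval : x y / x + y}.
Proof.
move=> x y; pose d := (msupp x `|` msupp y)%fset.
rewrite !(@freeEvalEw d) ?fsubsetUl ?fsubsetUr ?msuppD_le // -big_split.
by apply: eq_bigr => m _; rewrite mcoeffD rmorphD mulrDl.
Qed.

Lemma freeEval_zmod : zmod_morphism freeEval.
Proof.
by move=> x y; apply: (@addIr _ (freeEval y)); rewrite -freeEvalD !subrK.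
Qed.
HB.instance Definition _ := GRing.isZmodMorphism.Build _ _ freeEval freeEval_zmod.

Lemma freeEvalU (c : K) m : freeEval << c *g m >> = scal c * monEval m.
Proof.
by rewrite (freeEvalEw (@msuppU_le _ _ m c)) big_seq_fset1 mcoeffUU.
Qed.

Lemma freeEval_monoid : monoid_morphism freeEval.
Proof.
split=> [|x y].
  rewrite [X in freeEval X](_ : 1 = << 1 *g mone >>) // freeEvalU rmorph1 mul1r.
  by rewrite /monEval fm1 big_nil.
rewrite [x * y]malgME raddf_sum [freeEval x]/freeEval mulr_suml; apply: eq_bigr => m _.
rewrite raddf_sum [freeEval y]/freeEval mulr_sumr; apply: eq_bigr => m' _.
rewrite [LHS]freeEvalU rmorphM monEvalM -!mulrA; congr (_ * _).
by rewrite [RHS]mulrA -scalC -mulrA.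
Qed.
HB.instance Definition _ := GRing.isMonoidMorphism.Build _ _ freeEval freeEval_monoid.

Lemma freeEval_scal k : freeEval (scal k) = scal k.
Proof. by rewrite [LHS]freeEvalU /monEval fm1 big_nil mulr1. Qed.

Lemma freeEval_gen i : freeEval (freeGen K i) = g i.
Proof. by rewrite /freeGen freeEvalU rmorph1 mul1r /monEval fmuE big_seq1. Qed.

End FreeAlgebraUniversal.

Section FreeAlgebraHom.
Variables (K : comNzRingType) (G : choiceType) (B : pzAlgType K).

Lemma malgU_mul (c c' : K) (m m' : fmonom G) :
  (<< c *g m >> : freeAlg K G) * << c' *g m' >> = << c * c' *g mmul m m' >> :> freeAlg K G.
Proof. exact: fgmulUU. Qed.

Lemma freeAlg_hom_unique (f f' : {rmorphism freeAlg K G -> B}) :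
  is_alg_hom f -> is_alg_hom f' ->
  (forall i, f (freeGen K i) = f' (freeGen K i)) -> f =1 f'.
Proof.
move=> fK f'K fg x; rewrite [x]monalgE !rmorph_sum; apply: eq_bigr => m _.
have -> : << x@_m *g m >> = scal x@_m * (<< 1 *g m >> : freeAlg K G).
  by rewrite [RHS]malgU_mul mulr1 mul1m.
rewrite !rmorphM fK f'K; congr (_ * _).
case: m => s; elim: s => [|i s IHs].
  have -> : << 1 *g FMonom [::] >> = 1 :> freeAlg K G.
    by congr << 1 *g _ >>; apply/eqP; rewrite fmP fm1.
  by rewrite !rmorph1.
have -> : << 1 *g FMonom (i :: s) >> = freeGen K i * (<< 1 *g FMonom s >> : freeAlg K G).
  rewrite /freeGen malgU_mul mulr1; congr << 1 *g _ >>.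
  by apply/eqP; rewrite fmP fmM fmuE.
by rewrite !rmorphM fg IHs.
Qed.

End FreeAlgebraHom.

Section PresentedAlgebra.
Variables (K : comNzRingType) (G : choiceType) (S : freeAlg K G -> Prop).
Variable B : pzAlgType K.

Lemma presPi_zmod : zmod_morphism (presPi S).
Proof.
by move=> x y; apply: (@addIr _ (presPi S y)); rewrite -presPiD !subrK.
Qed.
HB.instance Definition _ := GRing.isZmodMorphism.Build _ _ (presPi S) presPi_zmod.
HB.instance Definition _ := GRing.isMonoidMorphism.Build _ _ (presPi S)
  (conj (presPi1 S) (@presPiM K G S)).

Lemma presPi_scal k : presPi S (scal k) = scal k. Proof. by []. Qed.

Lemma presPi_rel s : S s -> presPi S s = 0.
Proof.
move=> Ss; rewrite -[RHS](rmorph0 (presPi S)); apply/quotPiP; rewrite subr0.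
by rewrite -[s]mul1r -[_ * s]mulr1; apply: in_ideal_gen.
Qed.

Lemma pres_hom_unique (f f' : {rmorphism presAlg S -> B}) :
  is_alg_hom f -> is_alg_hom f' ->
  (forall i, f (presGen S i) = f' (presGen S i)) -> f =1 f'.
Proof.
move=> fK f'K fg x; case: (quotPi_surj x) => y <-.
apply: (@freeAlg_hom_unique _ _ _ (f \o presPi S) (f' \o presPi S)) => [k|k|i] /=.
- exact: fK.
- exact: f'K.
- exact: fg.
Qed.

Variable g : G -> B.
Hypothesis g_rel : forall s, S s -> freeEval g s = 0.

Definition presEval (x : presAlg S) : B := freeEval g (repr (x : idealQuot S)).

Lemma presEvalE x : presEval (presPi S x) = freeEval g x.
Proof.
suff: in_ideal S (x - repr (presPi S x)).
  move=> I0; apply/esym/eqP; rewrite /presEval -subr_eq0 -rmorphB; apply/eqP.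
  elim: I0 => [|a b _ ha _ hb|a s b Ss]; first exact: rmorph0.
    by rewrite rmorphD ha hb addr0.
  by rewrite !rmorphM /= (g_rel Ss) mulr0 mul0r.
by apply/quotPiP; rewrite [RHS]reprK.
Qed.

Lemma presEval_zmod : zmod_morphism presEval.
Proof.
move=> x y; case: (quotPi_surj x) (quotPi_surj y) => x' <- [y' <-].
rewrite -[quotPi S x' - _](presPi_zmod x' y').
by rewrite [LHS]presEvalE rmorphB /= -!presEvalE.
Qed.
Lemma presEval_monoid : monoid_morphism presEval.
Proof.
split=> [|x y]; first by rewrite -(presPi1 S) presEvalE rmorph1.
case: (quotPi_surj x) (quotPi_surj y) => x' <- [y' <-].
rewrite -[quotPi S x' * _](presPiM S x' y').
by rewrite [LHS]presEvalE rmorphM /= -!presEvalE.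
Qed.

(** Evaluation at g factors through the quotient by the relations. *)
Lemma presentation_hom : exists f : {rmorphism presAlg S -> B},
  is_alg_hom f /\ forall i, f (presGen S i) = g i.
Proof.
pose z := GRing.isZmodMorphism.Build _ _ presEval presEval_zmod.
pose m := GRing.isMonoidMorphism.Build _ _ presEval presEval_monoid.
pose f : {rmorphism presAlg S -> B} := HB.pack presEval z m.
exists f; split=> [k|i] /=; first by rewrite -presPi_scal [LHS]presEvalE freeEval_scal.
by rewrite [LHS]presEvalE freeEval_gen.
Qed.

End PresentedAlgebra.

Section TensorProduct.
Variables (K : comNzRingType) (A B : pzAlgType K).

Lemma tens_relE x y : tens_rel (A := A) (B := B) (x - y) ->
  presPi (@tens_rel K A B) x = presPi (@tens_rel K A B) y.
Proof. by move=> /presPi_rel; rewrite rmorphB => /eqP; rewrite subr_eq0 => /eqP. Qed.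

Lemma tensM (a a' : A) (b b' : B) : tens a b * tens a' b' = tens (a * a') (b * b').
Proof. by have := tens_relE (tens_relM a a' b b'); rewrite presPiM. Qed.
Lemma tens1 : tens (1 : A) (1 : B) = 1.
Proof. exact: tens_relE (tens_rel1 A B). Qed.
Lemma tensDl (a a' : A) (b : B) : tens (a + a') b = tens a b + tens a' b.
Proof. by have := tens_relE (tens_relDl a a' b); rewrite presPiD. Qed.
Lemma tensDr (a : A) (b b' : B) : tens a (b + b') = tens a b + tens a b'.
Proof. by have := tens_relE (tens_relDr a b b'); rewrite presPiD. Qed.
Lemma tensZl k (a : A) (b : B) : tens (scal k * a) b = scal k * tens a b.
Proof. by have := tens_relE (tens_relZl k a b); rewrite presPiM. Qed.
Lemma tensZr k (a : A) (b : B) : tens a (scal k * b) = scal k * tens a b.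
Proof. by have := tens_relE (tens_relZr k a b); rewrite presPiM. Qed.

Definition tensl (a : A) : tensAlg A B := tens a 1.
Definition tensr (b : B) : tensAlg A B := tens 1 b.

Lemma tensl_zmod : zmod_morphism tensl.
Proof. by move=> x y; apply: (@addIr _ (tensl y)); rewrite -tensDl !subrK. Qed.
Lemma tensl_monoid : monoid_morphism tensl.
Proof. by split=> [|x y]; [exact: tens1|rewrite /tensl tensM mulr1]. Qed.
Lemma tensr_zmod : zmod_morphism tensr.
Proof. by move=> x y; apply: (@addIr _ (tensr y)); rewrite -tensDr !subrK. Qed.
Lemma tensr_monoid : monoid_morphism tensr.
Proof. by split=> [|x y]; [exact: tens1|rewrite /tensr tensM mulr1]. Qed.
HB.instance Definition _ := GRing.isZmodMorphism.Build _ _ tensl tensl_zmod.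
HB.instance Definition _ := GRing.isMonoidMorphism.Build _ _ tensl tensl_monoid.
HB.instance Definition _ := GRing.isZmodMorphism.Build _ _ tensr tensr_zmod.
HB.instance Definition _ := GRing.isMonoidMorphism.Build _ _ tensr tensr_monoid.

Lemma tensl_hom : is_alg_hom tensl.
Proof. by move=> k; rewrite -[scal k]mulr1 /= /tensl tensZl tens1 mulr1. Qed.
Lemma tensr_hom : is_alg_hom tensr.
Proof. by move=> k; rewrite -[scal k]mulr1 /= /tensr tensZr tens1 mulr1. Qed.

Lemma tensE (a : A) (b : B) : tens a b = tensl a * tensr b.
Proof. by rewrite /tensl /tensr tensM mulr1 mul1r. Qed.
Lemma tenslrC (a : A) (b : B) : tensl a * tensr b = tensr b * tensl a.
Proof. by rewrite /tensl /tensr !tensM !mulr1 !mul1r. Qed.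

End TensorProduct.

(** * The generating matrix of a shifted algebra *)

Section LeadingExponents.
Variables (n : nat).
Hypothesis n_gt0 : (0 < n)%N.
Local Notation r := n.+1.
Implicit Types mu : Lambda r.

Lemma dominant_le mu i j : dominant mu -> (0 < i)%N -> (i <= j)%N -> (j <= r)%N ->
  dcoef mu j <= dcoef mu i.
Proof.
move=> dm i0; elim: j => [|j IHj]; first by lia.
rewrite leq_eqVlt => /orP[/eqP-> //|ij] jr.
have h : dcoef mu j.+1 <= dcoef mu j.
  by have := dm j; rewrite /coroot jr subr_ge0; apply; lia.
by apply: le_trans h (IHj _ _); lia.
Qed.

Lemma hdeg_nonincreasing mu : dominant mu -> nonincreasing (@hdeg r mu).
Proof.
move=> dm i j ij nij.
have last_le : dcoef mu r.+1 <= dcoef mu n.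
  by have := dm r; rewrite /coroot ltnn subr_ge0 /=; apply; lia.
have D := dominant_le dm.
have jN := ltn_ord j.
rewrite /hdeg; case: ifP => jr; case: ifP => ir.
- by apply: D; lia.
- lia.
- have [ni|ni] := eqVneq (i : nat) n.
    have nj : (j : nat) <> r.
      move=> jE; case/eqP: nij; congr (_, _); apply: val_inj; rewrite /= val_colN //; lia.
    have h : dcoef mu n <= dcoef mu (rev_ord j).+1 by apply: D; rewrite /=; lia.
    rewrite ni; lia.
  have h1 : dcoef mu r <= dcoef mu (rev_ord j).+1 by apply: D; rewrite /=; lia.
  have h2 : dcoef mu n <= dcoef mu i.+1 by apply: D; lia.
  lia.
- have h : dcoef mu (rev_ord i).+1 <= dcoef mu (rev_ord j).+1.
    by apply: D; rewrite /=; lia.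
  lia.
Qed.

Lemma hdegD mu1 mu2 (i : 'I_(2 * r)) :
  hdeg (mu1 + mu2) i = hdeg mu1 i + hdeg mu2 i.
Proof.
rewrite /hdeg /dcoef !ffunE; case: ifP => _ //.
by rewrite opprD; ring.
Qed.

End LeadingExponents.

Section GaussSeries.
Variables (r : nat) (A : pzRingType).
Implicit Types (g : gen r -> A) (mu : Lambda r).
Local Notation N := (2 * r)%N.

Lemma deg_Eser g i j : deg_le (if i == j then 0 else -1) (Eser g i j).
Proof.
move=> a; rewrite /Eser; case: eqP => _ ha; first by rewrite gt_eqF.
by rewrite ifF //; apply/negP => /andP[_]; lia.
Qed.
Lemma deg_Fser g i j : deg_le (if i == j then 0 else -1) (Fser g i j).
Proof.
move=> a; rewrite /Fser; case: eqP => _ ha; first by rewrite gt_eqF.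
by rewrite ifF //; apply/negP => /andP[_]; lia.
Qed.
Lemma deg_Hser mu g i : deg_le (hdeg mu i) (Hser mu g i).
Proof. by move=> a ha; rewrite /Hser gt_eqF // ltNge ltW. Qed.

Lemma Eser_bounded g i j : exists p, deg_le p (Eser g i j).
Proof. by eexists; apply: deg_Eser. Qed.
Lemma Fser_bounded g i j : exists p, deg_le p (Fser g i j).
Proof. by eexists; apply: deg_Fser. Qed.
Lemma Hser_bounded mu g i : exists p, deg_le p (Hser mu g i).
Proof. by eexists; apply: deg_Hser. Qed.

(** The series that define the matrix T, as elements of the ring of Laurent
    series. *)
Definition lE g i j : laurent A := Laurent (Eser_bounded g i j).
Definition lF g i j : laurent A := Laurent (Fser_bounded g i j).
Definition lH mu g i : laurent A := Laurent (Hser_bounded mu g i).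
Definition lT mu g (i j : 'I_N) : laurent A := \sum_k lF g i k * lH mu g k * lE g k j.

Lemma TserE mu g i j a : Tser mu g i j a = lT mu g i j a.
Proof. by rewrite lcoef_sum. Qed.

Lemma lT_gauss mu g : gauss (lT mu g) (lF g) (lH mu g) (lE g).
Proof. by []. Qed.
Lemma lF_unitri g : unitriL (lF g).
Proof.
split=> [i|i j ij]; apply: laurentP => a; rewrite ?lone /= /Fser ?eqxx //.
by rewrite -(inj_eq val_inj) /= ltn_eqF //= ltnNge ltnW.
Qed.
Lemma lE_unitri g : unitriU (lE g).
Proof.
split=> [i|i j ij]; apply: laurentP => a; rewrite ?lone /= /Eser ?eqxx //.
by rewrite -(inj_eq val_inj) /= gtn_eqF //= ltnNge ltnW.
Qed.
Lemma lF_near1 g : near1 (lF g).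
Proof.
split=> [i|i j ij]; first by rewrite (lF_unitri g).1; exact: lmonic1.
by have := @deg_Fser g i j; rewrite (negPf ij).
Qed.
Lemma lE_near1 g : near1 (lE g).
Proof.
split=> [i|i j ij]; first by rewrite (lE_unitri g).1; exact: lmonic1.
by have := @deg_Eser g i j; rewrite (negPf ij).
Qed.
Lemma lH_monic mu g i : lmonic (hdeg mu i) (lH mu g i).
Proof. by split; [exact: deg_Hser|rewrite /= /Hser eqxx]. Qed.

(** The assignment of values to the generators for which the series F, H and E
    are the given ones. *)
Definition gauss_gen mu (F : 'I_N -> 'I_N -> laurent A) (h : 'I_N -> laurent A)
    (E : 'I_N -> 'I_N -> laurent A) (x : gen r) : A :=
  let: (i, j, k) := x in
  if (i < j)%N then E i j (- k.+1%:Z) else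
  if (j < i)%N then F i j (- k.+1%:Z) else h i (hdeg mu i - k.+1%:Z).

Lemma gauss_genK mu g : gauss_gen mu (lF g) (lH mu g) (lE g) =1 g.
Proof.
case=> [[i j] k] /=; case: ltngtP => [ij|ji|/val_inj ij].
- by rewrite /Eser -(inj_eq val_inj) /= ltn_eqF // ij /=; congr g; congr (_, _); lia.
- by rewrite /Fser -(inj_eq val_inj) /= gtn_eqF // ji /=; congr g; congr (_, _); lia.
- rewrite -ij /Hser ifF; last by apply/eqP; lia.
  by rewrite ifT; [congr g; congr (_, _); lia|lia].
Qed.

Lemma lF_gauss_gen mu F h E : unitriL F -> near1 F ->
  forall i j, lF (gauss_gen mu F h E) i j = F i j.
Proof.
move=> [F1 F0] [_ Fn] i j; apply: laurentP => a /=; rewrite /Fser.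
have [->|ij] := eqVneq i j; first by rewrite F1 lone.
have [ji|ij'] := ltnP j i; last by rewrite F0 // ltn_neqAle ij' (inj_eq val_inj) ij.
rewrite /=; case: ltP => a0; last by rewrite Fn //; lia.
by rewrite ltnNge ltnW //= ji; congr (F i j _); lia.
Qed.
Lemma lE_gauss_gen mu F h E : unitriU E -> near1 E ->
  forall i j, lE (gauss_gen mu F h E) i j = E i j.
Proof.
move=> [E1 E0] [_ En] i j; apply: laurentP => a /=; rewrite /Eser.
have [->|ij] := eqVneq i j; first by rewrite E1 lone.
have [lij|ji] := ltnP i j; last first.
  by rewrite E0 // ltn_neqAle ji eq_sym (inj_eq val_inj) ij.
rewrite /=; case: ltP => a0; last by rewrite En //; lia.
by rewrite lij; congr (E i j _); lia.
Qed.
Lemma lH_gauss_gen mu F h E : (forall i, lmonic (hdeg mu i) (h i)) ->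
  forall i, lH mu (gauss_gen mu F h E) i = h i.
Proof.
move=> hm i; apply: laurentP => a /=; rewrite /Hser.
have [->|ai] := eqVneq a (hdeg mu i); first by rewrite (hm i).2.
case: ltP => ha; last by rewrite (hm i).1 // lt_neqAle eq_sym ai.
by rewrite /gauss_gen ltnn; congr (h i _); lia.
Qed.

(** Gauss decompositions are unique, so T determines its factors, and the values
    of the generators are coefficients of these. *)
Lemma lT_unique mu g g' : (forall i j, lT mu g i j = lT mu g' i j) -> g =1 g'.
Proof.
move=> TT; have T' : gauss (lT mu g) (lF g') (lH mu g') (lE g').
  by move=> i j; rewrite TT.
have [FF HH EE] := gauss_unique (fun i => lmonic_invertible (lH_monic mu g i))
  (lT_gauss mu g) (lF_unitri g) (lE_unitri g) T' (lF_unitri g') (lE_unitri g').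
move=> x; rewrite -(gauss_genK mu g x) -(gauss_genK mu g' x).
by case: x => [[i j] k]; rewrite /gauss_gen FF HH EE.
Qed.

End GaussSeries.

Section Naturality.
Variables (r : nat) (A B : pzRingType) (f : {rmorphism A -> B}) (mu : Lambda r).

Lemma lmap_lF (g : gen r -> A) i j : lmap f (lF g i j) = lF (f \o g) i j.
Proof.
apply: laurentP => a; rewrite /= /Fser.
case: ifP => _; first exact: rmorph_nat.
by case: ifP => _ //; rewrite rmorph0.
Qed.
Lemma lmap_lE (g : gen r -> A) i j : lmap f (lE g i j) = lE (f \o g) i j.
Proof.
apply: laurentP => a; rewrite /= /Eser.
case: ifP => _; first exact: rmorph_nat.
by case: ifP => _ //; rewrite rmorph0.
Qed.
Lemma lmap_lH (g : gen r -> A) i : lmap f (lH mu g i) = lH mu (f \o g) i.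
Proof.
apply: laurentP => a; rewrite /= /Hser.
case: ifP => _; first exact: rmorph1.
by case: ifP => _ //; rewrite rmorph0.
Qed.

Lemma lmap_lT (g : gen r -> A) i j : lmap f (lT mu g i j) = lT mu (f \o g) i j.
Proof.
rewrite rmorph_sum; apply: eq_bigr => k _.
by rewrite !rmorphM /= lmap_lF lmap_lE lmap_lH.
Qed.

Lemma Tser_natural (g : gen r -> A) i j a :
  f (Tser mu g i j a) = Tser mu (f \o g) i j a.
Proof. by rewrite !TserE -lmap_lT. Qed.

End Naturality.

Section RttNaturality.
Variables (K : fieldType) (r : nat) (A B : pzAlgType K) (f : {rmorphism A -> B}).
Hypothesis fK : is_alg_hom f.

Lemma polyzw_natural p s a b :
  f (polyzw p s a b) = polyzw p (fun a b => f (s a b)) a b.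
Proof.
rewrite /polyzw rmorph_sum; apply: eq_bigr => k _.
rewrite rmorphM fK; congr (_ * _).
elim: (nat_of_ord k) a b => [|m IHm] a b //.
by rewrite !iterS /mulzw rmorphB -!IHm.
Qed.

Lemma rttL_natural T x y a b :
  f (rttL (K := K) (r := r) T x y a b) = rttL (K := K) (fun i j c => f (T i j c)) x y a b.
Proof.
rewrite /rttL rmorph_sum; apply: eq_bigr => v _; rewrite polyzw_natural.
by congr polyzw; apply/funext => c; apply/funext => d; rewrite rmorphM.
Qed.
Lemma rttR_natural T x y a b :
  f (rttR (K := K) (r := r) T x y a b) = rttR (K := K) (fun i j c => f (T i j c)) x y a b.
Proof.
rewrite /rttR rmorph_sum; apply: eq_bigr => v _; rewrite polyzw_natural.
by congr polyzw; apply/funext => c; apply/funext => d; rewrite rmorphM.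
Qed.

End RttNaturality.

(** * The coproduct *)

Section Coproduct.
Variables (K : numFieldType) (n : nat).
Hypothesis n_gt1 : (1 < n)%N.
Local Notation r := n.+1.
Local Notation N := (2 * r)%N.

Lemma lT_lrtt mu (A : pzAlgType K) (f : {rmorphism Xrtt K mu -> A}) :
  is_alg_hom f -> lrtt (lT mu (f \o @Xgen K r mu)).
Proof.
move=> fK; apply/lrttP => x y a b.
pose pi : {rmorphism freeAlg K (gen r) -> Xrtt K mu} := presPi (@rtt_rel K r mu).
pose T := Tser mu (freeGen K (G := gen r)).
have TE : (fun i j c => lT mu (f \o @Xgen K r mu) i j c) =
    (fun i j c => (f \o pi) (T i j c)).
  apply/funext => i; apply/funext => j; apply/funext => c.
  by rewrite /T Tser_natural TserE.
have hK : is_alg_hom (f \o pi) by move=> k; rewrite /= -[RHS]fK.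
rewrite -[LHS]/(rttL (fun i j c => lT mu (f \o @Xgen K r mu) i j c) x y a b).
rewrite -[RHS]/(rttR (fun i j c => lT mu (f \o @Xgen K r mu) i j c) x y a b).
rewrite TE -(rttL_natural hK) -(rttR_natural hK).
apply/eqP; rewrite -subr_eq0 -rmorphB /=.
by rewrite (@presPi_rel _ _ (@rtt_rel K r mu)) ?rmorph0 //; apply: Rtt_rel.
Qed.

Lemma lT_shifted_gauss mu (A : pzAlgType K) (g : gen r -> A) :
  shifted_gauss (@hdeg r mu) (lT mu g) (lF g) (lH mu g) (lE g).
Proof.
split; [exact: lT_gauss|exact: lF_unitri|exact: lE_unitri|exact: lF_near1|
  exact: lE_near1|exact: lH_monic].
Qed.

Lemma lT_gauss_gen mu (A : pzAlgType K) T F h E :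
  shifted_gauss (K := K) (n := n) (A := A) (@hdeg r mu) T F h E ->
  forall i j, lT mu (gauss_gen mu F h E) i j = T i j.
Proof.
move=> [TE FL EU Fn En hm] i j; rewrite TE; apply: eq_bigr => k _.
by rewrite lF_gauss_gen // lE_gauss_gen // lH_gauss_gen.
Qed.

Lemma lT_commute (A1 A2 A : pzAlgType K) (f1 : {rmorphism A1 -> A})
    (f2 : {rmorphism A2 -> A}) mu1 mu2 (g1 : gen r -> A1) (g2 : gen r -> A2) :
  (forall x y, f1 x * f2 y = f2 y * f1 x) ->
  forall i j k l a b, lT mu1 (f1 \o g1) i j a * lT mu2 (f2 \o g2) k l b =
    lT mu2 (f2 \o g2) k l b * lT mu1 (f1 \o g1) i j a.
Proof. by move=> c12 i j k l a b; rewrite -!lmap_lT c12. Qed.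

Lemma shifted_gauss_product (A : pzAlgType K) d1 d2
    (T1 T2 : 'I_N -> 'I_N -> laurent A) F1 h1 E1 F2 h2 E2 :
  lrtt T1 -> lrtt T2 -> shifted_gauss d1 T1 F1 h1 E1 -> shifted_gauss d2 T2 F2 h2 E2 ->
  nonincreasing d1 -> nonincreasing d2 ->
  (forall i j k l a b, T1 i j a * T2 k l b = T2 k l b * T1 i j a) ->
  exists T, [/\ T = (fun i j => \sum_k T1 i k * T2 k j), lrtt T &
    exists F h E, shifted_gauss (fun i => d1 i + d2 i) T F h E].
Proof.
move=> r1 r2 s1 s2 m1 m2 c; exists (fun i j => \sum_k T1 i k * T2 k j).
by split=> //; [exact: lrtt_mul|exact: shifted_gauss_mul s1 s2 _ _ _].
Qed.

(** The coefficients of the factors F, H, E are the only possible images of the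
    generators, and they satisfy the defining relations because T does. *)
Lemma Xrtt_universal (mu : Lambda r) (B : pzAlgType K) (T F : 'I_N -> 'I_N -> laurent B) h E :
  lrtt T -> shifted_gauss (K := K) (@hdeg r mu) T F h E ->
  exists f : {rmorphism Xrtt K mu -> B},
    [/\ is_alg_hom f, forall i j m, f (tser K mu i j m) = T i j m
      & forall f' : {rmorphism Xrtt K mu -> B}, is_alg_hom f' ->
          (forall i j m, f' (tser K mu i j m) = T i j m) -> f' =1 f].
Proof.
move=> rttT sg; pose g := gauss_gen mu F h E.
have Tg : lT mu g = T.
  by apply/funext => i; apply/funext => j; exact: lT_gauss_gen.
have gE : freeEval g \o freeGen K (G := gen r) = g.
  by apply/funext => z; exact: freeEval_gen.
pose ev : {rmorphism freeAlg K (gen r) -> B} := freeEval g.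
have evK : is_alg_hom ev := freeEval_scal g.
have g_rel s : rtt_rel mu s -> freeEval g s = 0.
  case=> x y a b T0.
  have TE : (fun i j c => ev (T0 i j c)) = (fun i j => lcoef (T i j)).
    apply/funext => i; apply/funext => j; apply/funext => c.
    rewrite -Tg -TserE -[X in Tser _ X]gE.
    exact: (Tser_natural ev mu (freeGen K (G := gen r)) i j c).
  have eL := rttL_natural evK T0 x y a b; have eR := rttR_natural evK T0 x y a b.
  have e0 : ev (rttL T0 x y a b) - ev (rttR T0 x y a b) = 0.
    rewrite TE in eL eR; rewrite [X in X - _]eL [X in _ - X]eR.
    by rewrite [X in X - _]((lrttP T).1 rttT) subrr.
  by rewrite -e0 -rmorphB.
have [f [fK fg]] := presentation_hom g_rel.
have tserE (D : {rmorphism Xrtt K mu -> B}) i j m :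
    D (tser K mu i j m) = lT mu (D \o @Xgen K r mu) i j m.
  by rewrite [LHS]Tser_natural TserE.
exists f; split=> // [i j m|f' f'K f'T].
  rewrite tserE (_ : f \o @Xgen K r mu = g) ?Tg //.
  by apply/funext => z; exact: fg.
apply: pres_hom_unique => // z; rewrite fg.
have /(_ z) // : f' \o @Xgen K r mu =1 g.
by apply: (@lT_unique _ _ mu) => i j; apply: laurentP => m; rewrite -tserE f'T Tg.
Qed.

Lemma mul_tens (mu1 mu2 : Lambda r) i j m :
  (\sum_k lT mu1 (@tensl K (Xrtt K mu1) (Xrtt K mu2) \o @Xgen K r mu1) i k *
     lT mu2 (@tensr K (Xrtt K mu1) (Xrtt K mu2) \o @Xgen K r mu2) k j) m =
  \sum_(k < N) convol (@tens K _ _) (tser K mu1 i k) (tser K mu2 k j) m.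
Proof.
rewrite lcoef_sum; apply: eq_bigr => k _; rewrite lcoefM.
apply: eq_fsbigr => a _.
by rewrite tensE /tser !Tser_natural !TserE.
Qed.

Lemma coproduct_exists (mu1 mu2 : Lambda r) : dominant mu1 -> dominant mu2 ->
  exists Delta : {rmorphism Xrtt K (mu1 + mu2)%R -> tensAlg (Xrtt K mu1) (Xrtt K mu2)},
  [/\ is_alg_hom Delta, maps_T_to_TT Delta
    & forall Delta' : {rmorphism Xrtt K (mu1 + mu2)%R ->
          tensAlg (Xrtt K mu1) (Xrtt K mu2)},
        is_alg_hom Delta' -> maps_T_to_TT Delta' -> Delta' =1 Delta].
Proof.
move=> dom1 dom2.
have n_gt0 : (0 < n)%N by apply: ltnW.
have [T [TE rttT [F [h [E sg]]]]] := shifted_gauss_product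
  (lT_lrtt (@tensl_hom K (Xrtt K mu1) (Xrtt K mu2)))
  (lT_lrtt (@tensr_hom K (Xrtt K mu1) (Xrtt K mu2)))
  (@lT_shifted_gauss mu1 _ _) (@lT_shifted_gauss mu2 _ _)
  (hdeg_nonincreasing n_gt0 dom1) (hdeg_nonincreasing n_gt0 dom2)
  (@lT_commute _ _ _ (@tensl K (Xrtt K mu1) (Xrtt K mu2)) (@tensr K _ _)
    mu1 mu2 (@Xgen K r mu1) (@Xgen K r mu2) (@tenslrC K _ _)).
rewrite (_ : (fun i => _) = @hdeg r (mu1 + mu2)) in sg; last first.
  by apply/funext => i; rewrite hdegD.
have [f [fK fT fU]] := Xrtt_universal rttT sg.
have TT i j m : T i j m =
    \sum_(k < N) convol (@tens K _ _) (tser K mu1 i k) (tser K mu2 k j) m.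
  by rewrite TE mul_tens.
exists f; split=> [|i j m|f' f'K f'T]; first exact: fK.
  by rewrite fT; exact: TT.
by apply: fU f'K _ => i j m; rewrite TT; exact: f'T.
Qed.

End Coproduct.

Theorem proposition2p158 (R : realType) (r : nat) (hr : (3 <= r)%N)
    (mu1 mu2 : Lambda r) (hmu1 : dominant mu1) (hmu2 : dominant mu2) :
  exists Delta : {rmorphism Xrtt (complex R) (mu1 + mu2)%R ->
      tensAlg (Xrtt (complex R) mu1) (Xrtt (complex R) mu2)},
    [/\ is_alg_hom Delta, maps_T_to_TT Delta
      & forall Delta' : {rmorphism Xrtt (complex R) (mu1 + mu2)%R ->
            tensAlg (Xrtt (complex R) mu1) (Xrtt (complex R) mu2)},
          is_alg_hom Delta' -> maps_T_to_TT Delta' -> Delta' =1 Delta].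
Proof.
case: r hr mu1 mu2 hmu1 hmu2 => // n n_gt1 mu1 mu2 dom1 dom2.
exact: (@coproduct_exists (complex R) n).
Qed.
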